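(* Let $1<p<\infty$ and let $\omega:\mathbb{R}_+\to\mathbb{R}_+$ be continuous with $\omega\in B_p(0)$, i.e. $\int_0^1\omega(\tau)^{-1/(p-1)}\,d\tau<\infty$. Put $$\Omega^0_\omega(t):=\Big(\int_0^t\omega(\tau)^{-\frac{1}{p-1}}\,d\tau\Big)^{1-\frac1p},\qquad t>0,$$ and for $c\in\mathbb{R}$ define the following subsets of $D^{1,p}(\mathbb{R}_+,\omega)$: $$\mathcal{R}^0_{p,\omega}(c):=\Big\{u\in D^{1,p}(\mathbb{R}_+,\omega):\ u(t)=\int_0^t u'(\tau)\,d\tau+c\ \text{ for all } t>0\Big\}$$ (where $u'\in L^p(\mathbb{R}_+,\omega)$), $$\mathcal{A}^0_{p,\omega}(c):=\Big\{u\in D^{1,p}(\mathbb{R}_+,\omega):\ \text{there exists a sequence } t_n\searrow 0 \text{ with } \lim_{n\to\infty}u(t_n)=c\Big\},$$ $$\mathcal{B}^0_{p,\omega}(c):=\Big\{u\in D^{1,p}(\mathbb{R}_+,\omega):\ \lim_{t\to0}u(t)=c\Big\},$$ $$\mathcal{C}^0_{p,\omega}(c):=\Big\{u\in D^{1,p}(\mathbb{R}_+,\omega):\ \lim_{t\to0}\frac{u(t)-c}{\Omega^0_\omega(t)}=0,\ \ \sup_{t>0}\frac{u(t)-c}{\Omega^0_\omega(t)}<\infty\Big\}.$$ Then: (i) For every $c\in\mathbb{R}$, $\mathcal{R}^0_{p,\omega}(c)$ is a closed subset of $D^{1,p}(\mathbb{R}_+,\omega)$ equipped with any of the norms $\|\cdot\|^{(a)}_{D^{1,p}(\mathbb{R}_+,\omega)}$,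 $a\in\mathbb{R}_+$. (ii) For every $c\in\mathbb{R}$, $\mathcal{A}^0_{p,\omega}(c)=\mathcal{B}^0_{p,\omega}(c)=\mathcal{C}^0_{p,\omega}(c)=\mathcal{R}^0_{p,\omega}(c)$. (iii) For every $u\in D^{1,p}(\mathbb{R}_+,\omega)$ there is $c\in\mathbb{R}$ such that $u\in\mathcal{R}^0_{p,\omega}(c)$. In particular the trace operator $Tr^0(u):=\lim_{t\to0}u(t)$ is well defined for every $u\in D^{1,p}(\mathbb{R}_+,\omega)$, and $D^{1,p}(\mathbb{R}_+,\omega)=\bigcup_{c\in\mathbb{R}}\mathcal{R}^0_{p,\omega}(c)$. Moreover, $$D^{1,p}(\mathbb{R}_+,\omega)=\Big\{u(t)=\int_0^t v(\tau)\,d\tau+c:\ c\in\mathbb{R},\ v\in L^p(\mathbb{R}_+,\omega)\Big\}.$$ (iv) The quantity $\|u\|^{(0)}_{D^{1,p}(\mathbb{R}_+,\omega)}:=\|u'\|_{L^p(\mathbb{R}_+,\omega)}+|Tr^0(u)|$ is a norm on $D^{1,p}(\mathbb{R}_+,\omega)$, which is equivalent to any norm $\|\cdot\|^{(a)}_{D^{1,p}(\mathbb{R}_+,\omega)}$, $a\in\mathbb{R}_+$.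
   Context: $\mathbb{R}_+=(0,\infty)$. For a weight $\omega$, $L^p(\mathbb{R}_+,\omega)$ is the space of (classes of) measurable real functions $f$ with $\|f\|_{L^p(\mathbb{R}_+,\omega)}=\big(\int_0^\infty|f(t)|^p\omega(t)\,dt\big)^{1/p}<\infty$. The weighted Dirichlet space is $$D^{1,p}(\mathbb{R}_+,\omega)=\{u:\mathbb{R}_+\to\mathbb{R}:\ u\text{ is locally absolutely continuous on }\mathbb{R}_+\text{ and }\|u'\|_{L^p(\mathbb{R}_+,\omega)}<\infty\}.$$ For $a\in\mathbb{R}_+$ it carries the norm $\|u\|^{(a)}_{D^{1,p}(\mathbb{R}_+,\omega)}:=\|u'\|_{L^p(\mathbb{R}_+,\omega)}+|u(a)|$. *)

(* Defs.v *)
From HB Require Import structures.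
From mathcomp Require Import all_boot all_order all_algebra.
From mathcomp Require Import all_classical all_reals all_analysis.
Set Implicit Arguments.
Unset Strict Implicit.
Unset Printing Implicit Defensive.
Import Order.TTheory GRing.Theory Num.Theory.
Import numFieldNormedType.Exports.
Local Open Scope classical_set_scope.
Local Open Scope ring_scope.

(* Functions on (0, +oo) are represented by functions on R.  An element of a
   function space is represented by its extension by 0 to R, so that equality
   of representatives is equality on (0, +oo). *)
Definition Rplus (R : realType) : set R := `]0, +oo[.
Arguments Rplus : clear implicits.

Definition zero_extended (R : realType) (u : R -> R) : Prop :=
  forall t, ~ Rplus R t -> u t = 0.

(* Degenerate intervals (s i = t i) are allowed: they contribute nothing. *)
Definition abs_continuous_on (R : realType) (a b : R) (u : R -> R) : Prop :=
  forall e : R, 0 < e -> exists2 d : R, 0 < d &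
    forall (n : nat) (s t : 'I_n -> R),
      (forall i, a <= s i /\ s i <= t i /\ t i <= b) ->
      trivIset [set: 'I_n] (fun i => `]s i, t i[%classic) ->
      \sum_i (t i - s i) < d ->
      \sum_i `|u (t i) - u (s i)| < e.

Definition loc_abs_continuous (R : realType) (u : R -> R) : Prop :=
  forall a b : R, 0 < a -> a < b -> abs_continuous_on a b u.

Definition wLnorm (R : realType) (p : R) (w f : R -> R) : \bar R :=
  ((\int[lebesgue_measure]_(t in Rplus R) (`|f t| `^ p * w t)%:E) `^ p^-1)%E.

Definition wLp (R : realType) (p : R) (w : R -> R) : set (R -> R) :=
  [set f | measurable_fun (Rplus R) f /\ (wLnorm p w f < +oo)%E].

(* u' is the pointwise derivative, which exists almost everywhere on (0, +oo)
   for a locally absolutely continuous u; on the remaining null set derive1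
   takes a fixed default value. *)
Definition D1p (R : realType) (p : R) (w : R -> R) : set (R -> R) :=
  [set u | [/\ zero_extended u, loc_abs_continuous u & wLp p w u^`()%classic]].

Definition D1p_norm (R : realType) (p : R) (w : R -> R) (a : R)
    (u : R -> R) : R :=
  fine (wLnorm p w u^`()%classic) + `|u a|.

Definition in_Bp0 (R : realType) (p : R) (w : R -> R) : Prop :=
  (\int[lebesgue_measure]_(t in `]0%R, 1%R[) (w t `^ (- (p - 1)^-1))%:E
     < +oo)%E.

Definition Omega0 (R : realType) (p : R) (w : R -> R) (t : R) : R :=
  (\int[lebesgue_measure]_(x in `]0, t[) (w x `^ (- (p - 1)^-1)))
    `^ (1 - p^-1).

(* u(t) = \int_0^t v + c for all t > 0, including that the integrals exist
   (Rintegral alone is total). *)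
Definition primitive_from0 (R : realType) (v : R -> R) (c : R)
    (u : R -> R) : Prop :=
  forall t, 0 < t ->
    lebesgue_measure.-integrable `]0, t[ (EFin \o v) /\
    u t = \int[lebesgue_measure]_(x in `]0, t[) v x + c.

Definition calR0 (R : realType) (p : R) (w : R -> R) (c : R) : set (R -> R) :=
  [set u | D1p p w u /\ primitive_from0 u^`()%classic c u].

Definition calA0 (R : realType) (p : R) (w : R -> R) (c : R) : set (R -> R) :=
  [set u | D1p p w u /\ exists t_ : nat -> R,
    [/\ forall n, 0 < t_ n, nonincreasing_seq t_,
        t_ n @[n --> \oo] --> (0 : R) & u (t_ n) @[n --> \oo] --> c]].

Definition calB0 (R : realType) (p : R) (w : R -> R) (c : R) : set (R -> R) :=
  [set u | D1p p w u /\ u t @[t --> 0^'+] --> c].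

Definition calC0 (R : realType) (p : R) (w : R -> R) (c : R) : set (R -> R) :=
  [set u | [/\ D1p p w u,
    (u t - c) / Omega0 p w t @[t --> 0^'+] --> (0 : R) &
    (ereal_sup [set ((u t - c) / Omega0 p w t)%:E | t in Rplus R] < +oo)%E]].

Definition Tr0 (R : realType) (u : R -> R) : R := lim (u t @[t --> 0^'+]).

Definition D1p_norm0 (R : realType) (p : R) (w : R -> R) (u : R -> R) : R :=
  fine (wLnorm p w u^`()%classic) + `|Tr0 u|.

(* V cannot be taken to be a type of elements of D without first proving that
   D is a linear subspace, so this is stated relative to D. *)
Definition norm_on (R : realType) (V : lmodType R) (D : set V)
    (N : V -> R) : Prop :=
  [/\ D 0, forall (k : R) u v, D u -> D v -> D (k *: u + v),
      forall u v, D u -> D v -> N (u + v) <= N u + N v,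
      forall (k : R) u, D u -> N (k *: u) = `|k| * N u &
      forall u, D u -> 0 <= N u /\ (N u = 0 -> u = 0)].

Definition equivalent_norms_on (R : realType) (V : lmodType R) (D : set V)
    (N1 N2 : V -> R) : Prop :=
  exists k K : R, [/\ 0 < k, 0 < K &
    forall u, D u -> k * N1 u <= N2 u /\ N2 u <= K * N1 u].

(* A contains every point of D in its closure for the metric N (u - v). *)
Definition norm_closed_in (R : realType) (V : lmodType R) (D : set V)
    (N : V -> R) (A : set V) : Prop :=
  A `<=` D /\
  forall u, D u ->
    (forall e : R, 0 < e -> exists2 v, A v & N (u - v) < e) -> A u.

(* Main.v *)
Require Import Defs.
From HB Require Import structures.
From mathcomp Require Import all_boot all_order all_algebra.
From mathcomp Require Import all_classical all_reals all_analysis.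
From mathcomp Require Import measurable_realfun ring lra.
Set Implicit Arguments.
Unset Strict Implicit.
Unset Printing Implicit Defensive.
Import Order.TTheory GRing.Theory Num.Theory.
Import numFieldNormedType.Exports.
Local Open Scope classical_set_scope.
Local Open Scope ring_scope.

(** The idea is an estimate of u near the origin in terms of its derivative.

    Write u' for the derivative of an element u of the Dirichlet space.
    Hoelder's inequality for the factors |u'| w^(1/p) and w^(-1/p) gives

      int_0^t |u'| <= (int_0^t |u'|^p w)^(1/p) * Omega t,

    where Omega t is finite by the condition B_p(0) and the continuity of w
    (wLp_primitive_estimate).  So u' is integrable up to 0.  Since
    u t - u s = int_s^t u' for 0 < s <= t, the difference u t - int_0^t u' is a
    constant c (D1p_primitive), and

      |u t - c| <= (int_0^t |u'|^p w)^(1/p) * Omega t.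

    The first factor is bounded by the norm of u' and tends to 0 with t.  Hence
    u tends to c at 0, faster than Omega, and c is the trace of u.  Each of the
    four classes in the statement turns out to be the level set of the trace at
    c (calR0E, calA0E, calB0E, calC0E), because a limit of u along a sequence,
    or a limit of (u - c) / Omega, determines the trace.

    At a point a the inequality reads |u a - Tr u| <= Omega a * ||u'||, so that
    replacing |u a| by |Tr u| changes the norm by a factor of at most
    1 + Omega a.  This gives the equivalence of norms; it also makes the trace
    continuous, so its level sets are closed.

    The formula u t - u s = int_s^t u' is Lebesgue's fundamental theorem for
    absolutely continuous functions.  The total variation of such a function is
    absolutely continuous (total_variation_family), which splits the function
    into two absolutely continuous monotone functions (abs_cont_jordan).  The
    Stieltjes measure of a monotone absolutely continuous function vanishes on
    Lebesgue-null sets (lebesgue_stieltjes_null), so it has a Radon-Nikodym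
    density (nondecreasing_abs_cont_density), and Lebesgue's differentiation
    theorem identifies the density with the derivative
    (primitive_derivable_ae).  Conversely, primitives of locally integrable
    functions are absolutely continuous (primitive_from0_abs_continuous); this
    gives the description of the space as a set of primitives.

    Measurability of u' on a Borel set has to be proved for the pointwise
    derivative itself (measurable_derive1), through the Cauchy criterion for
    difference quotients. *)

(** * Absolutely continuous functions on the line *)

Section families.
Context {R : realType}.
Implicit Types (K L : R * R) (l : seq (R * R)) (f g : R -> R).

(** A closed form of disjointness for the open intervals: it is preserved by
    every nondecreasing map, also when an interval collapses to a point, and it
    is decidable. *)
Definition separated K L := (K.2 <= L.1) || (L.2 <= K.1).

Definition interval_family l :=
  all (fun K => K.1 <= K.2) l && pairwise separated l.

Definition total_length l := \sum_(K <- l) (K.2 - K.1).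

Definition total_increment f l := \sum_(K <- l) `|f K.2 - f K.1|.

(** Absolute continuity on the whole line, phrased with lists rather than with
    finite families indexed by ordinals, so that an interval of the family can
    be replaced by a partition of it. *)
Definition abs_cont f := forall e : R, 0 < e -> exists2 d : R, 0 < d &
  forall l, interval_family l -> total_length l < d -> total_increment f l < e.

Definition clamp (a b x : R) := Num.max a (Num.min x b).

Lemma clamp_le a b x y : x <= y -> clamp a b x <= clamp a b y.
Proof. by move=> xy; rewrite /clamp ge_max !le_max lexx/= le_min !ge_min xy lexx/= !orbT. Qed.

Lemma clamp_id a b x : a <= x -> x <= b -> clamp a b x = x.
Proof. by move=> ax xb; rewrite /clamp (min_idPl xb) (max_idPr ax). Qed.

Lemma clamp_itv a b x : a <= b -> a <= clamp a b x <= b.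
Proof. by move=> ab; rewrite /clamp le_max lexx ge_max ab/= ge_min lexx orbT. Qed.

Lemma clamp_dist a b x y : x <= y -> clamp a b y - clamp a b x <= y - x.
Proof.
move=> xy; rewrite /clamp; case: (leP y b) => yb; case: (leP x b) => xb;
  case: (leP a y) => ay; case: (leP a x) => ax; case: (leP a b) => ab; lra.
Qed.

Lemma interval_family_map (h : R -> R) l : {homo h : x y / x <= y} ->
  interval_family l -> interval_family [seq (h K.1, h K.2) | K <- l].
Proof.
move=> hm /andP[l1 l2]; apply/andP; split.
  by rewrite all_map; apply: sub_all l1 => K /= /hm.
rewrite pairwise_map; apply: sub_pairwise l2 => K L /= /orP[] /hm h'.
  by rewrite /separated /= h'.
by rewrite /separated /= h' orbT.
Qed.

(** Precomposition with such a map shortens the intervals of a family and keeps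
    them separated, so it preserves absolute continuity. Clamping to a segment
    and truncating from below are the two examples in use. *)
Definition monotone_contraction (m : R -> R) :=
  forall x y, x <= y -> 0 <= m y - m x <= y - x.

Definition image_family (m : R -> R) l := [seq (m K.1, m K.2) | K <- l].

Lemma monotone_contraction_clamp a b : monotone_contraction (clamp a b).
Proof. by move=> x y xy; rewrite subr_ge0 clamp_le//= clamp_dist. Qed.

Lemma monotone_contraction_max a : monotone_contraction (Num.max a).
Proof. by move=> x y xy; case: (leP a x) => h1; case: (leP a y) => h2; lra. Qed.

Lemma image_family_short m l d : monotone_contraction m -> interval_family l ->
  total_length l < d ->
  interval_family (image_family m l) /\ total_length (image_family m l) < d.
Proof.
move=> cm fl ld; split.
  by apply: interval_family_map fl => x y /cm/andP[+ _]; rewrite subr_ge0.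
apply: le_lt_trans ld; rewrite /total_length big_map.
rewrite big_seq [leRHS]big_seq; apply: ler_sum => K Kl /=.
by move/andP: fl => [/allP/(_ _ Kl)/cm/andP[]].
Qed.

Lemma abs_cont_comp m f : monotone_contraction m -> abs_cont f -> abs_cont (f \o m).
Proof.
move=> cm acf e /acf[d d0 H]; exists d => // l fl ld.
have [fl' ld'] := image_family_short cm fl ld.
by have := H _ fl' ld'; rewrite /total_increment big_map.
Qed.

(** Clamping extends a function from [a, b] to the line by constants, so that
    the later arguments need no bookkeeping of the segment. *)
Lemma abs_continuous_on_clamp a b f : a <= b -> abs_continuous_on a b f ->
  abs_cont (f \o clamp a b).
Proof.
move=> ab acf e /acf[d d0 H]; exists d => // l fl ld.
pose l' := image_family (clamp a b) l.
have [fl' ll'] := image_family_short (monotone_contraction_clamp a b) fl ld.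
pose s (i : 'I_(size l')) := (nth (0, 0) l' i).1.
pose t (i : 'I_(size l')) := (nth (0, 0) l' i).2.
have := H (size l') s t; rewrite /total_increment.
have -> : \sum_(K <- l) `|(f \o clamp a b) K.2 - (f \o clamp a b) K.1| =
    \sum_i `|f (t i) - f (s i)|.
  transitivity (\sum_(K <- l') `|f K.2 - f K.1|); first by rewrite big_map.
  by rewrite (big_nth (0, 0)) big_mkord.
have -> : \sum_i (t i - s i) = total_length l'.
  by rewrite /total_length (big_nth (0, 0)) big_mkord.
apply; last exact: ll'.
- move=> i; have := mem_nth (0, 0) (ltn_ord i).
  rewrite /s /t; set K := nth _ _ _ => Kl.
  have /andP[/allP/(_ _ Kl) I12 _] := fl'.
  move: Kl I12 => /mapP[L _ ->] /= ->.
  by have /andP[-> _] := clamp_itv L.1 ab; have /andP[_ ->] := clamp_itv L.2 ab.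
- move=> i j _ _ [x [/=]]; rewrite !in_itv/= => /andP[sx xt] /andP[sx' xt'].
  apply/val_inj/eqP; rewrite /=; apply: contraT => ij.
  have /andP[_ /(pairwiseP (0, 0)) pl] := fl'.
  wlog ij' : i j sx xt sx' xt' ij / (i < j)%N.
    by move=> W; case: (ltngtP i j) => h; [exact: (W i j)|apply: (W j i); rewrite // eq_sym|
      rewrite h eqxx in ij].
  have := pl i j (ltn_ord i) (ltn_ord j) ij'; rewrite /separated.
  rewrite -/(s i) -/(s j) -/(t i) -/(t j).
  by case/orP; lra.
Qed.

Lemma abs_contB f g : abs_cont f -> abs_cont g -> abs_cont (fun x => f x - g x).
Proof.
move=> acf acg e e0.
have [d d0 H] := acf _ (divr_gt0 e0 (ltr0Sn R 1)).
have [d' d'0 H'] := acg _ (divr_gt0 e0 (ltr0Sn R 1)).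
exists (Num.min d d'); first by rewrite lt_min d0.
move=> l fl; rewrite lt_min => /andP[/(H _ fl) h /(H' _ fl) h'].
rewrite [e]splitr; apply: le_lt_trans (ltrD h h').
rewrite /total_increment -big_split/=; apply: ler_sum => K _.
rewrite (_ : _ - _ = (f K.2 - f K.1) - (g K.2 - g K.1)); last by ring.
exact: ler_normB.
Qed.

(** The list of the intervals cut out by the points of a partition starting at
    a. *)
Definition consecutive (a : R) (s : seq R) := zip (a :: s) s.

Lemma consecutive_itv a b s K : itv_partition a b s -> K \in consecutive a s ->
  [/\ a <= K.1, K.1 <= K.2 & K.2 <= b].
Proof.
elim: s a => [//|h t ih] a abs; rewrite inE => /predU1P[->|Kt].
  have [/= /andP[ah _] _] := abs; split; rewrite ?lexx//; first exact: ltW.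
  exact: (itv_partition_le (itv_partition_cons abs)).
have [h1 h2 h3] := ih h (itv_partition_cons abs) Kt; split => //.
by have [/= /andP[/ltW ah _] _] := abs; exact: le_trans h1.
Qed.

Lemma interval_family_consecutive a b s : itv_partition a b s ->
  interval_family (consecutive a s).
Proof.
move=> abs; apply/andP; split.
  by apply/allP => K /(consecutive_itv abs)[].
elim: s a abs => [//|h t ih] a abs; rewrite [pairwise _ _]/= ih ?andbT; last first.
  exact: itv_partition_cons abs.
by apply/allP => K /(consecutive_itv (itv_partition_cons abs))[h1 _ _]; rewrite /separated h1.
Qed.

Lemma total_length_consecutive a b s : itv_partition a b s ->
  total_length (consecutive a s) = b - a.
Proof.
elim: s a => [|h t ih] a abs.
  by rewrite (itv_partition_nil abs) /total_length big_nil subrr.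
rewrite /total_length big_cons/=.
have := ih h (itv_partition_cons abs); rewrite /total_length /consecutive => ->.
by lra.
Qed.

Lemma variation_consecutive a b f s : itv_partition a b s ->
  variation a b f s = total_increment f (consecutive a s).
Proof.
move=> abs; rewrite (variation_zip _ abs) /total_increment /consecutive.
elim: s a {abs} => [|h t ih] a; first by rewrite !big_nil.
by rewrite /= !big_cons/= ih.
Qed.

Lemma interval_family_refine l1 l2 a b s : itv_partition a b s ->
  interval_family (l1 ++ (a, b) :: l2) ->
  interval_family ((l1 ++ consecutive a s) ++ l2).
Proof.
move=> abs; rewrite /interval_family !all_cat !pairwise_cat /= allrel_consr.
move=> /andP[/and3P[al1 ab al2] /and4P[/andP[l1ab l1l2] pl1 l2ab pl2]].
have /andP[aC pC] := interval_family_consecutive abs.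
rewrite al1 aC al2 pl1 pC pl2 allrel_catl l1l2/= !andbT; apply/andP; split.
  apply/allrelP => K L /(consecutive_itv abs)[h1 _ h2] /(allP l2ab).
  rewrite /separated /= => /orP[h3|h3]; first by rewrite (le_trans h2).
  by rewrite (le_trans h3)// orbT.
apply/allrelP => K L /(allP l1ab) + /(consecutive_itv abs)[h1 _ h2].
rewrite /separated /= => /orP[h3|h3]; first by rewrite (le_trans h3).
by rewrite (le_trans h2)// orbT.
Qed.

Lemma total_length_refine l1 l2 a b s : itv_partition a b s ->
  total_length ((l1 ++ consecutive a s) ++ l2) = total_length (l1 ++ (a, b) :: l2).
Proof.
move=> abs; have := total_length_consecutive abs; rewrite /total_length !big_cat big_cons/= => ->.
by rewrite addrA.
Qed.

Notation TV := total_variation.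

(** The bound e on increments passes to total variations. By induction on l2,
    its intervals are moved one after the other to l1, each cut along an
    arbitrary partition; the family stays admissible because cutting does not
    change the total length, and taking the supremum over the partitions turns
    the increments into a total variation. *)
Lemma total_variation_family f (e d : R) :
  (forall l, interval_family l -> total_length l < d -> total_increment f l < e) ->
  forall l2 l1, interval_family (l1 ++ l2) -> total_length (l1 ++ l2) < d ->
  ((total_increment f l1)%:E + \sum_(K <- l2) TV K.1 K.2 f <= e%:E)%E.
Proof.
move=> H; elim => [|[a b] l2 ih] l1 fl ld.
  by rewrite big_nil adde0 lee_fin ltW// H//; rewrite cats0 in fl ld.
rewrite big_cons/=.
have ab : a <= b by move: fl; rewrite /interval_family all_cat/= => /andP[/and3P[]].
set S := (\sum_(K <- l2) _)%E.
have S0 : (0 <= S)%E.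
  rewrite /S big_seq; apply: sume_ge0 => K Kl2; apply: total_variation_ge0.
  move: fl; rewrite /interval_family all_cat/= => /andP[/and3P[_ _ /allP]].
  by move=> /(_ _ Kl2).
have step s : itv_partition a b s ->
    ((total_increment f l1 + variation a b f s)%:E + S <= e%:E)%E.
  move=> abs; rewrite (variation_consecutive _ abs).
  have -> : total_increment f l1 + total_increment f (consecutive a s) =
      total_increment f (l1 ++ consecutive a s) by rewrite /total_increment big_cat.
  by apply: ih; [exact: interval_family_refine abs fl|rewrite (total_length_refine _ _ abs)].
have [ab'|nab] := eqVneq a b.
  have : itv_partition a b [::] by split=> //=; rewrite ab'.
  by move/step; rewrite /variation big_nil addr0 ab' total_variationxx add0e.
have {nab}ab : a < b by rewrite lt_neqAle nab.
have Sfin : S \is a fin_num.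
  rewrite ge0_fin_numE//; have := step _ (itv_partition1 ab).
  by case: (S) S0 => //= r; rewrite ltry.
set A := total_increment f l1.
suff : (TV a b f <= e%:E - A%:E - S)%E.
  by rewrite leeBrDr// leeBrDl// addeA.
apply: ge_ereal_sup => _ [_ [s abs <-] <-].
rewrite leeBrDr// leeBrDl// addeA -EFinD; exact: step.
Qed.

Lemma abs_cont_total_variation f (e : R) : abs_cont f -> 0 < e -> exists2 d : R, 0 < d &
  forall l, interval_family l -> total_length l < d ->
    (\sum_(K <- l) TV K.1 K.2 f < e%:E)%E.
Proof.
move=> acf e0; have [d d0 H] := acf _ (divr_gt0 e0 (ltr0Sn R 1)).
exists d => // l fl ld; have := @total_variation_family _ _ _ H l [::] fl ld.
rewrite /total_increment big_nil add0e => /le_lt_trans; apply.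
by rewrite lte_fin ltr_pdivrMr// ltr_pMr// ltr1n.
Qed.

(** Total variation is at most 1 on each interval shorter than the d associated
    with the bound 1; finitely many such intervals lead from a to x. *)
Lemma abs_cont_total_variation_fin f a x : abs_cont f -> a <= x -> TV a x f \is a fin_num.
Proof.
move=> acf; have [d d0 H] := abs_cont_total_variation acf ltr01.
have step y z : y <= z -> z - y < d -> TV y z f \is a fin_num.
  move=> yz zyd; rewrite ge0_fin_numE; last exact: total_variation_ge0.
  have := H [:: (y, z)]; rewrite /interval_family /total_length !big_seq1/= yz.
  by move=> /(_ isT zyd)/lt_trans; apply; rewrite ltry.
have main n : forall z, a <= z -> z <= a + n%:R * (d / 2) -> TV a z f \is a fin_num.
  elim: n => [|n ih] z az zn.
    by apply: step => //; rewrite mul0r addr0 in zn; lra.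
  have [zn'|zn'] := leP z (a + n%:R * (d / 2)); first exact: ih.
  have na : a <= a + n%:R * (d / 2) by rewrite lerDl mulr_ge0// divr_ge0// ltW.
  rewrite (total_variationD _ na (ltW zn')) fin_numD ih//=; apply: step; first exact: ltW.
  by rewrite -natr1 mulrDl mul1r in zn; lra.
move=> ax; apply: (main (Num.bound ((x - a) / (d / 2)))) => //.
rewrite -lerBlDl -ler_pdivrMr ?divr_gt0//.
by apply/ltW/archi_boundP; rewrite divr_ge0 ?subr_ge0// divr_ge0// ltW.
Qed.

(** The Jordan decomposition of f into its total variation g from a and the
    difference g - f, both absolutely continuous. Points below a are sent to a,
    so that g and h are monotone on the whole line. *)
Lemma abs_cont_jordan f (a : R) : abs_cont f ->
  exists g h : R -> R, [/\ {homo g : x y / x <= y}, {homo h : x y / x <= y},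
    abs_cont g, abs_cont h & forall x, a <= x -> f x = g x - h x].
Proof.
move=> acf; pose m x := Num.max a x; pose g x := fine (TV a (m x) f).
have am x : a <= m x by rewrite /m le_max lexx.
have mle x y : x <= y -> m x <= m y.
  by move=> xy; rewrite /m ge_max !le_max lexx/= xy orbT.
have gB x y : x <= y -> g y - g x = fine (TV (m x) (m y) f).
  move=> xy; rewrite /g (total_variationD f (am x) (mle _ _ xy)).
  by rewrite fineD ?abs_cont_total_variation_fin ?mle// addrC addKr.
have fTV x y : x <= y -> `|f (m y) - f (m x)| <= g y - g x.
  move=> xy; rewrite gB// -lee_fin fineK ?abs_cont_total_variation_fin ?mle//.
  by apply: total_variation_ge; exact: mle.
have acm : abs_cont (f \o m) by exact: abs_cont_comp (monotone_contraction_max a) acf.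
have acg : abs_cont g.
  move=> e e0; have [d d0 H] := abs_cont_total_variation acf e0.
  exists d => // l fl ld.
  have [fl' ld'] := image_family_short (monotone_contraction_max a) fl ld.
  have := H _ fl' ld'; rewrite -lte_fin; apply: le_lt_trans.
  rewrite big_map/= /total_increment -sumEFin big_seq [leRHS]big_seq.
  apply: lee_sum => K Kl; move/andP: fl => [/allP/(_ _ Kl) k12 _].
  by rewrite gB// ger0_norm ?fine_ge0 ?total_variation_ge0 ?mle// fineK// abs_cont_total_variation_fin// mle.
exists g, (fun x => g x - (f \o m) x); split => //.
- by move=> x y xy; rewrite -subr_ge0 gB// fine_ge0// total_variation_ge0// mle.
- move=> x y /fTV; rewrite ler_norml => /andP[_] /=; lra.
- exact: abs_contB.
- by move=> x ax; rewrite /= /m (max_idPr ax); ring.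
Qed.

End families.

(** * Densities of absolutely continuous functions *)

Section lebesgue_stieltjes_density.
Context {R : realType}.
Implicit Types (G : R -> R) (a b : R).
Local Notation mu := (@lebesgue_measure R).

Lemma open_interval_inf_sup (I : set R) a b : open I -> is_interval I ->
  I `<=` `]a, b[ -> I !=set0 -> I = `]inf I, sup I[%classic.
Proof.
move=> oI iI Iab I0.
have hI : has_inf I by split=> //; exists a => x /Iab; rewrite /= in_itv/= => /andP[/ltW].
have hS : has_sup I by split=> //; exists b => x /Iab; rewrite /= in_itv/= => /andP[_ /ltW].
apply/seteqP; split => x /=; rewrite in_itv/=.
  move=> Ix; have /nbhs_ballP[e /= e0 xe] := open_nbhs_nbhs (conj oI Ix).
  have I1 : I (x - e / 2).
    by apply: xe; rewrite /ball/= opprB addrC subrK gtr0_norm ?divr_gt0//; lra.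
  have I2 : I (x + e / 2).
    by apply: xe; rewrite /ball/= opprD addrA subrr add0r normrN gtr0_norm ?divr_gt0//; lra.
  have := ge_inf hI.2 I1; have := ub_le_sup hS.2 I2; lra.
move=> /andP[/(inf_lt I0)[y Iy yx] /(sup_gt I0)[z Iz xz]].
by apply: (iI y z) => //; rewrite !ltW.
Qed.

Lemma abs_cont_continuous (f : R -> R) : abs_cont f -> continuous f.
Proof.
move=> acf x; apply/cvgrPdist_lt => e /acf[d d0 H].
have step y z : y <= z -> z - y < d -> `|f z - f y| < e.
  move=> yz yzd; have := H [:: (y, z)].
  by rewrite /interval_family /total_length /total_increment !big_seq1/= yz; exact.
near=> y.
have : `|x - y| < d by near: y; exact: cvgr_dist_lt.
have [xy|/ltW yx] := leP x y; first by rewrite distrC [`|f _ - _|]distrC ger0_norm ?subr_ge0//; exact: step.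
by rewrite ger0_norm ?subr_ge0//; exact: step.
Unshelve. all: by end_near. Qed.

Lemma lebesgue_stieltjes_itvoc (G : cumulative R R) a b : a <= b ->
  lebesgue_stieltjes_measure G `]a, b]%classic = (G b - G a)%:E.
Proof.
move=> ab; rewrite /lebesgue_stieltjes_measure /measure_extension measurable_mu_extE/=; last exact: is_ocitv.
by rewrite wlength_itv_bnd.
Qed.

(** A Lebesgue-null set lies in an open set of small measure, which is a
    countable disjoint union of open intervals. Finitely many of them form an
    interval family of small total length, so absolute continuity of G bounds
    the sum of their Stieltjes measures. *)
Lemma lebesgue_stieltjes_null (G : cumulative R R) (N : set R) a b : abs_cont G ->
  measurable N -> mu N = 0%E ->
  lebesgue_stieltjes_measure G (N `&` `]a, b]%classic) = 0%E.
Proof.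
move=> acG mN N0; pose nu : {measure set (measurableTypeR R) -> \bar R} := lebesgue_stieltjes_measure G.
rewrite -[lebesgue_stieltjes_measure G _]/(nu _).
have mNab : measurable (N `&` `]a, b]%classic) by exact: measurableI.
apply/eqP; rewrite eq_le measure_ge0 andbT; apply/lee_addgt0Pr => e e0.
rewrite add0e.
have [d d0 H] := acG _ e0.
have [|U [oU NU UNd]] := lebesgue_regularity_outer mN _ d0.
  by rewrite [X in (X < _)%E]N0 ltry.
have Ud : (mu U < d%:E)%E.
  rewrite -(setDUK NU); apply: le_lt_trans (measureU2 _ _ _) _ => //.
    by apply: measurableD => //; exact: open_measurable.
  by rewrite [X in (X + _)%E]N0 add0e.
(* The intervals must be bounded to have a finite infimum and supremum. *)
pose U' := U `&` `]a - 1, b + 1[%classic.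
have oU' : open U' by apply: openI => //; exact: interval_open.
pose I := open_disjoint_itv oU'.
have IU' k : I k `<=` U' by rewrite (open_disjoint_itv_bigcup oU'); exact: bigcup_sup.
have mI k : measurable (I k) by apply: open_measurable; exact: open_disjoint_itv_open.
have IE k : I k !=set0 -> I k = `]inf (I k), sup (I k)[%classic /\ inf (I k) < sup (I k).
  move=> I0; have E : I k = `]inf (I k), sup (I k)[%classic.
    apply: (@open_interval_inf_sup _ (a - 1) (b + 1)) => //.
    - exact: open_disjoint_itv_open.
    - exact: open_disjoint_itv_is_interval.
    - by apply: (subset_trans (IU' k)) => x [].
  split => //; case: I0 => x; rewrite {1}E/= in_itv/= => /andP[]; exact: lt_trans.
have Iin k z : I k !=set0 -> inf (I k) < z < sup (I k) -> I k z.
  by move=> /IE[E _] zk; rewrite E /= in_itv.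
have U'E : U' = \bigcup_k I k by exact: open_disjoint_itv_bigcup.
have tI : trivIset setT I by exact: open_disjoint_itv_trivIset.
have sumI (m : {measure set (measurableTypeR R) -> \bar R}) :
    m U' = (\sum_(k <oo) m (I k))%E.
  rewrite U'E; apply: measure_semi_bigcup => //.
  by rewrite -U'E; exact: open_measurable.
have mU' : measurable U' by exact: open_measurable.
apply: (@le_trans _ _ (nu U')).
  apply: le_measure; rewrite ?inE// => x [/NU Ux]; rewrite /= in_itv/= => /andP[ax xb].
  by split => //=; rewrite in_itv/=; apply/andP; split; lra.
rewrite sumI.
apply: lime_le; first by apply: is_cvg_nneseries => *; exact: measure_ge0.
apply: nearW => n.
(* Empty components are discarded: their infimum and supremum are the default
   value 0, which might lie inside another component. *)
pose r := [seq k <- iota 0 n | `[< I k !=set0 >]].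
pose l := [seq (inf (I k), sup (I k)) | k <- r].
have rI k : k \in r -> I k !=set0 by rewrite mem_filter => /andP[/asboolP].
have sumr (m : {measure set (measurableTypeR R) -> \bar R}) :
    (\sum_(0 <= k < n) m (I k) = \sum_(k <- r) m (I k))%E.
  rewrite /r big_filter /index_iota subn0 [RHS]big_mkcond/=; apply: eq_bigr => k _.
  case: asboolP => // I0; rewrite (_ : I k = set0) ?measure0//.
  by apply/eqP; apply/negPn/negP => /set0P.
have fl : interval_family l.
  apply/andP; split.
    by apply/allP => _ /mapP[k /rI/IE[_ /ltW] ? ->].
  rewrite pairwise_map; apply/(pairwiseP 0%N) => i j; rewrite !inE => ir jr ij.
  have /IE[Ei ci] := rI _ (mem_nth 0%N ir); have /IE[Ej cj] := rI _ (mem_nth 0%N jr).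
  rewrite /separated/=; apply/negPn/negP; rewrite negb_or -!ltNge => /andP[h1 h2].
  set s := nth 0%N r i in Ei ci h1 h2; set t := nth 0%N r j in Ej cj h1 h2.
  have : s = t.
    apply: tI => //.
    pose lo := Num.max (inf (I s)) (inf (I t)); pose hi := Num.min (sup (I s)) (sup (I t)).
    have lohi : lo < hi by rewrite /lo /hi lt_min !gt_max ci cj h1 h2.
    have slo : inf (I s) <= lo by rewrite le_max lexx.
    have shi : hi <= sup (I s) by rewrite ge_min lexx.
    have tlo : inf (I t) <= lo by rewrite le_max lexx orbT.
    have thi : hi <= sup (I t) by rewrite ge_min lexx orbT.
    exists ((lo + hi) / 2); split.
      by apply: Iin; [exact: rI (mem_nth _ _)|lra].
    by apply: Iin; [exact: rI (mem_nth _ _)|lra].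
  move/eqP; rewrite nth_uniq//; first by rewrite ltn_eqF.
  exact/filter_uniq/iota_uniq.
have ld : total_length l < d.
  rewrite -lte_fin; apply: le_lt_trans Ud; apply: (@le_trans _ _ (mu U')); last first.
    by apply: le_measure; rewrite ?inE//; [exact: open_measurable|exact: subIsetl].
  rewrite sumI.
  apply: (@le_trans _ _ (\sum_(0 <= k < n) mu (I k))%E); last first.
    by apply: nneseries_lim_ge => *; exact: measure_ge0.
  rewrite sumr /total_length big_map -sumEFin big_seq [leRHS]big_seq.
  apply: lee_sum => k /rI/IE[E c]; have := lebesgue_measure_itv `]inf (I k), sup (I k)[.
  by rewrite -E /= lte_fin c => ->.
apply/ltW; rewrite sumr; have := H _ fl ld; rewrite -lte_fin; apply: le_lt_trans.
rewrite /total_increment big_map -sumEFin big_seq [leRHS]big_seq.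
apply: lee_sum => k /rI/IE[E c] /=; rewrite E.
apply: (@le_trans _ _ (nu `]inf (I k), sup (I k)]%classic)).
  by apply: le_measure; rewrite ?inE//; exact: subset_itv_oo_oc.
have := lebesgue_stieltjes_itvoc G (ltW c); rewrite -[lebesgue_stieltjes_measure G _]/(nu _) => ->.
by rewrite -E lee_fin ler_norm.
Qed.

(** The Radon-Nikodym density of the Stieltjes measure of G, restricted to ]a,
    b] to make it finite. *)
Lemma nondecreasing_abs_cont_density G a b : {homo G : x y / x <= y} -> abs_cont G -> a <= b ->
  exists g : R -> R, mu.-integrable [set: R] (EFin \o g) /\
    forall x, a <= x <= b -> G x - G a = \int[mu]_(t in `]a, x]) g t.
Proof.
move=> nd acG ab.
pose Gc : cumulative R R := HB.pack G (isCumulative.Build R _ R G nd (right_continuousW (abs_cont_continuous acG))).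
pose nu : {measure set (measurableTypeR R) -> \bar R} := lebesgue_stieltjes_measure Gc.
have mab : measurable (`]a, b]%classic : set (measurableTypeR R)) by exact: measurable_itv.
have nuab : (nu `]a, b]%classic < +oo)%E by rewrite /nu/= lebesgue_stieltjes_itvoc// ltry.
have dom : mfrestr mab nuab `<< mu.
  apply/null_content_dominatesP => N mN N0.
  exact: (@lebesgue_stieltjes_null Gc).
have [h [h0 hfin ih hE]] := radon_nikodym_sigma_finite dom.
exists (fine \o h); split.
  by apply: eq_integrable ih => // x _ /=; rewrite fineK.
move=> x /andP[ax xb].
rewrite /Rintegral.
under eq_integral do rewrite /= fineK//.
rewrite -hE//= /mfrestr /mrestr.
rewrite (_ : _ `&` _ = `]a, x]%classic) ?lebesgue_stieltjes_itvoc//.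
by apply: setIidl => y /=; rewrite !in_itv/= => /andP[-> /le_trans]; apply.
Qed.

(** The hard half of the fundamental theorem of calculus: the Jordan
    decomposition reduces it to monotone functions. *)
Lemma abs_continuous_on_density (u : R -> R) a b : a <= b -> abs_continuous_on a b u ->
  exists h : R -> R, mu.-integrable [set: R] (EFin \o h) /\
    forall x, a <= x <= b -> u x - u a = \int[mu]_(t in `]a, x]) h t.
Proof.
move=> ab /(abs_continuous_on_clamp ab) acu.
have [G [H [ndG ndH acG acH uE]]] := abs_cont_jordan a acu.
have [g [ig gE]] := nondecreasing_abs_cont_density ndG acG ab.
have [k [ik kE]] := nondecreasing_abs_cont_density ndH acH ab.
exists (fun x => g x - k x); split.
  rewrite (_ : _ \o _ = (EFin \o g) \- (EFin \o k))%E; last by apply/funext => x; rewrite /= EFinB.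
  exact: integrableB.
move=> x /[dup] axb /andP[ax xb].
rewrite RintegralB//; [|exact: integrableS ig|exact: integrableS ik].
rewrite -gE// -kE//.
have := uE x ax; have := uE a (lexx a); rewrite /= !clamp_id//.
by move=> -> ->; ring.
Qed.

End lebesgue_stieltjes_density.

(** * Measurability of the pointwise derivative *)

Section derivative_measurability.
Context {R : realType}.
Implicit Types (u : R -> R) (x h : R).

Lemma RplusE x : Rplus R x = (0 < x) :> Prop.
Proof. by rewrite /Rplus /= in_itv/= andbT. Qed.

Definition diff_quotient u x h := h^-1 *: (u (h + x) - u x).

(** The points where difference quotients with increments below 1/(m+1)
    oscillate by more than 1/(k+1). Letting the increments range over all
    reals, and not over a countable set, is harmless since the union of open
    sets is open. *)
Definition oscillating_quotient u (k m : nat) : set R :=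
  [set x | 0 < x /\ exists h h' : R,
    [/\ 0 < `|h| < m.+1%:R^-1, 0 < `|h'| < m.+1%:R^-1, `|h| < x, `|h'| < x &
        k.+1%:R^-1 < `|diff_quotient u x h - diff_quotient u x h'|]].

Lemma open_oscillating_quotient u k m : (forall x, 0 < x -> {for x, continuous u}) ->
  open (oscillating_quotient u k m).
Proof.
move=> cu; rewrite openE => x [x0 [h [h' [hm hm' hx hx' kq]]]].
have cq z : `|z| < x -> {for x, continuous (diff_quotient u ^~ z)}.
  move=> zx; apply: cvgZr; apply: cvgB; last exact: cu.
  apply: (@continuous_comp _ _ _ (fun y => z + y) u).
    by apply: cvgD; [exact: cvg_cst|exact: cvg_id].
  by apply: cu; move: zx; rewrite ltr_norml => /andP[]; lra.
have cqq : {for x, continuous (fun y => `|diff_quotient u y h - diff_quotient u y h'|)}.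
  apply: (@continuous_comp _ _ _ (fun y => diff_quotient u y h - diff_quotient u y h') Num.norm).
    by apply: continuousB; exact: cq.
  exact: norm_continuous.
near=> y; split; first by near: y; exact: lt_nbhsr.
exists h, h'; split => //.
- by near: y; exact: lt_nbhsr.
- by near: y; exact: lt_nbhsr.
- by near: y; exact: (cvgr_gt _ cqq _ kq).
Unshelve. all: by end_near. Qed.

Definition derivable_points u := [set x | 0 < x /\ cvg (diff_quotient u x h @[h --> 0^'])].

(** The Cauchy criterion for the difference quotient. *)
Lemma derivable_pointsE u :
  derivable_points u = Rplus R `\` \bigcup_k \bigcap_m oscillating_quotient u k m.
Proof.
apply/seteqP; split => x.
  move=> [x0 /cvg_ex[l /= /cvgrPdist_lt ql]]; split; first by rewrite RplusE.
  move=> [k _ kx].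
  have e0 : 0 < k.+1%:R^-1 / 2 :> R by rewrite divr_gt0.
  have /nbhs_ballP[d /= d0 dl] := ql _ e0.
  have [m md] : exists m : nat, m.+1%:R^-1 < d.
    have [m _ /(_ m (leqnn m))] := near_infty_natSinv_lt (PosNum d0).
    by exists m.
  have [_ [h [h' [/andP[h0 hm] /andP[h0' hm'] _ _]]]] := kx m I.
  apply/negP; rewrite -leNgt.
  have H z : 0 < `|z| -> `|z| < m.+1%:R^-1 -> `|l - diff_quotient u x z| < k.+1%:R^-1 / 2.
    move=> z0 zm; apply: dl => /=; last by rewrite -normr_gt0.
    by rewrite /ball/= sub0r normrN (lt_trans zm).
  have := H _ h0 hm; have := H _ h0' hm'.
  move=> lq' lq; rewrite (splitr k.+1%:R^-1) -(subrKA l).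
  by apply: le_trans (ler_normD _ _) _; rewrite lerD ?(ltW lq')// distrC ltW.
move=> []; rewrite RplusE => x0 nb; split => //.
apply/cauchy_cvgP; apply: cauchy_exP => e e0.
have [k ke] : exists k : nat, k.+1%:R^-1 < e.
  have [k _ /(_ k (leqnn k))] := near_infty_natSinv_lt (PosNum e0).
  by exists k.
have [m nm] : exists m, ~ oscillating_quotient u k m x.
  apply/existsNP => H; apply: nb; exists k => // m _; exact: H.
pose d := Num.min m.+1%:R^-1 x.
have d0 : 0 < d by rewrite lt_min x0 invr_gt0 ltr0n.
have Q h h' : 0 < `|h| < d -> 0 < `|h'| < d ->
    `|diff_quotient u x h - diff_quotient u x h'| <= k.+1%:R^-1.
  rewrite !lt_min => /andP[h0 /andP[hm hx]] /andP[h0' /andP[hm' hx']].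
  rewrite leNgt; apply/negP => abs; apply: nm; split => //.
  by exists h, h'; split => //; apply/andP.
exists (diff_quotient u x (d / 2)).
apply/nbhs_ballP; exists d => //= h /=; rewrite /ball/= sub0r normrN => hd h0.
apply: le_lt_trans ke; apply: Q; first by rewrite gtr0_norm ?divr_gt0//; apply/andP; split; lra.
by rewrite normr_gt0 h0.
Qed.

Lemma measurable_derivable_points u : (forall x, 0 < x -> {for x, continuous u}) ->
  measurable (derivable_points u).
Proof.
move=> cu; rewrite derivable_pointsE; apply: measurableD; first exact: measurable_itv.
apply: bigcup_measurable => k _; apply: bigcap_measurable => // m _.
by apply: open_measurable; exact: open_oscillating_quotient.
Qed.

Lemma measurable_zero_extended u : zero_extended u ->
  (forall x, 0 < x -> {for x, continuous u}) -> measurable_fun setT u.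
Proof.
move=> zu cu; have mR : measurable (Rplus R) by exact: measurable_itv.
rewrite -(setUv (Rplus R)); apply/measurable_funU => //; first exact: measurableC.
split.
  apply: open_continuous_measurable_fun; first exact: interval_open.
  by move=> x; rewrite inE RplusE => /cu.
apply: (eq_measurable_fun (cst (0 : R)) _ (@measurable_cst _ _ _ _ _ _)).
by move=> x; rewrite inE => /zu ->.
Qed.

(** The derivative is the limit of the quotients with increments 1/(n+1) on the
    Borel set where it exists, and a constant elsewhere. Almost-everywhere
    equality with a Borel function would not give this, since Borel sets are
    not complete for Lebesgue measure. *)
Lemma measurable_derive1 u : zero_extended u ->
  (forall x, 0 < x -> {for x, continuous u}) -> measurable_fun (Rplus R) u^`()%classic.
Proof.
move=> zu cu; have mu := measurable_zero_extended zu cu.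
have mD := measurable_derivable_points cu.
have DR : derivable_points u `<=` Rplus R.
  by move=> x [x0 _]; rewrite RplusE.
rewrite -(setDUK DR); apply/measurable_funU => //.
  by apply: measurableD => //; exact: measurable_itv.
split; last first.
  apply: (eq_measurable_fun (cst (point : R)) _ (@measurable_cst _ _ _ _ _ _)).
  move=> x; rewrite inE => -[]; rewrite RplusE => x0 nD.
  by rewrite /derive1 dvgP// => cx; apply: nD; split.
(* The increments 1/(n+1) tend to 0 without taking the value 0. *)
apply: (@measurable_fun_cvg _ _ _ _ (fun n x => diff_quotient u x n.+1%:R^-1)).
  move=> n; apply: measurable_funTS; apply: measurable_funM => //.
  apply: measurable_funB => //.
  by apply: measurableT_comp => //; exact: measurable_funD.
move=> x [x0 cx]; rewrite /derive1.
apply: (@cvg_comp _ _ _ (fun n : nat => n.+1%:R^-1 : R) (diff_quotient u x) _ (0^')) => //.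
move=> A /nbhs_ballP[e /= e0 eA].
have := near_infty_natSinv_lt (PosNum e0); apply: filterS => n /= ne.
apply: eA; first by rewrite /ball/= sub0r normrN gtr0_norm.
by rewrite gt_eqF.
Qed.
End derivative_measurability.

(** * The fundamental theorem of calculus *)

Section fundamental_theorem.
Context {R : realType}.
Implicit Types (u f v : R -> R) (a b c t x : R).
Local Notation mu := (@lebesgue_measure R).

Lemma ae_impl (P Q : R -> Prop) : (forall x, P x -> Q x) ->
  {ae mu, forall x, P x} -> {ae mu, forall x, Q x}.
Proof. by move=> PQ; apply: filterS; first exact: (ae_filter_ringOfSetsType mu). Qed.

Lemma loc_abs_continuous_continuous u x : loc_abs_continuous u -> 0 < x ->
  {for x, continuous u}.
Proof.
move=> acu x0; have x2 : 0 < x / 2 by rewrite divr_gt0.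
have xx : x / 2 < x * 2 by lra.
have := abs_cont_continuous (abs_continuous_on_clamp (ltW xx) (acu _ _ x2 xx)) (x := x).
have near_x : \forall y \near x, u y = (u \o clamp (x / 2) (x * 2)) y.
  near=> y; rewrite /= clamp_id// ltW//; near: y.
    by apply: lt_nbhsr; lra.
  by apply: lt_nbhsl; lra.
rewrite /continuous_at /= clamp_id; [|lra|lra]; apply: cvg_trans.
by apply: near_eq_cvg; apply: filterS near_x => y /= ->.
Unshelve. all: by end_near. Qed.

Lemma loc_abs_continuous_measurable_derive1 u : zero_extended u -> loc_abs_continuous u ->
  measurable_fun (Rplus R) u^`()%classic.
Proof.
by move=> zu acu; apply: measurable_derive1 => // x; exact: loc_abs_continuous_continuous.
Qed.

(** Lebesgue's differentiation theorem, applied to the restriction of f to ]a,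
    b], whose primitive from -oo differs from u by a constant there. *)
Lemma primitive_derivable_ae u f a b : mu.-integrable [set: R] (EFin \o f) ->
  (forall x, a <= x <= b -> u x - u a = \int[mu]_(t in `]a, x]) f t) ->
  {ae mu, forall x, a < x < b -> derivable u x 1 /\ u^`()%classic x = f x}.
Proof.
move=> intf uE.
have mab : measurable (`]a, b]%classic : set R) by exact: measurable_itv.
have iab : mu.-integrable `]a, b] (EFin \o f) by exact: integrableS intf.
have ig y : mu.-integrable `]-oo, y] (EFin \o (f \_ `]a, b])).
  apply: (@integrableS _ _ _ mu [set: R]) => //.
  by rewrite -restrict_EFin; apply/integrable_restrict => //=; rewrite setTI.
have := FTC1Ny ig (integrable_locally mab iab).
apply: ae_impl => x /= FE /andP[ax xb].
set F := (fun x => _) in FE.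
have near_x : \forall y \near x, (F \+ cst (u a)) y = u y.
  near=> y.
  have ay : a <= y by apply/ltW; near: y; exact: lt_nbhsr.
  have yb : y <= b by apply/ltW; near: y; exact: lt_nbhsl.
  rewrite /F /= -Rintegral_mkcondr (_ : _ `&` _ = `]a, y]%classic); last first.
    apply/seteqP; split => z /=; rewrite !in_itv/=; first by move=> [-> /andP[->]].
    by move=> /andP[-> zy]; rewrite zy (le_trans zy).
  by rewrite -uE ?ay// subrK.
clearbody F; case: FE => dF FE.
have dc := @derivable_cst R R R (u a) x 1.
have dFc : derivable (F \+ cst (u a)) x 1 by exact: (derivableD dF dc).
split; first exact: near_eq_derivable dFc.
have fx : (f \_ `]a, b]) x = f x by rewrite patchE mem_set//= in_itv/= ax ltW.
move: FE; rewrite -fx !derive1E => <-.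
rewrite -(near_eq_derive (1 : R) near_x) -[RHS]addr0 -[in RHS](@derive_cst R R R (u a) x 1).
exact: (deriveD dF dc).
Unshelve. all: by end_near. Qed.

Lemma loc_abs_continuous_density u a b : loc_abs_continuous u -> 0 < a -> a < b ->
  exists h : R -> R, [/\ mu.-integrable [set: R] (EFin \o h),
    forall x, a <= x <= b -> u x - u a = \int[mu]_(t in `]a, x]) h t &
    {ae mu, forall x, a < x < b -> derivable u x 1 /\ u^`()%classic x = h x}].
Proof.
move=> acu a0 ab; have [h [ih hE]] := abs_continuous_on_density (ltW ab) (acu _ _ a0 ab).
by exists h; split => //; exact: primitive_derivable_ae.
Qed.

(** The half-line is the union of the intervals ]1/(n+2), n+2[. *)
Lemma ae_itv_exhaust (P : R -> Prop) :
  (forall a b, 0 < a -> a < b -> {ae mu, forall x, a < x < b -> P x}) ->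
  {ae mu, forall x, 0 < x -> P x}.
Proof.
move=> H.
have : {ae mu, forall x (n : nat), n.+2%:R^-1 < x < n.+2%:R -> P x}.
  apply: ae_foralln => n; apply: H; first by rewrite invr_gt0.
  by apply: (@lt_trans _ _ 1); rewrite ?invf_lt1 ?ltr1n.
apply: ae_impl => x Px x0.
have [n nx] : exists n : nat, n.+1%:R^-1 < x.
  have [k _ /(_ k (leqnn k))] := near_infty_natSinv_lt (PosNum x0).
  by exists k.
pose m := maxn n (Num.bound x); apply: (Px m); apply/andP; split.
  apply: le_lt_trans nx; rewrite lef_pV2 ?posrE ?ltr0n// ler_nat.
  by rewrite ltnS ltnW// ltnS leq_maxl.
apply: (lt_le_trans (archi_boundP (ltW x0))); rewrite ler_nat.
by rewrite (leq_trans (leq_maxr n _))// /m ltnW// ltnW.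
Qed.

Lemma loc_abs_continuous_derivable u : loc_abs_continuous u ->
  {ae mu, forall x, 0 < x -> derivable u x 1}.
Proof.
move=> acu; apply: ae_itv_exhaust => a b a0 ab.
have [h [_ _]] := loc_abs_continuous_density acu a0 ab.
by apply: ae_impl => x H /H[].
Qed.

Lemma ae_eq_integrable (D : set R) (f g : R -> R) : measurable D ->
  measurable_fun D f -> mu.-integrable D (EFin \o g) ->
  {ae mu, forall x, D x -> f x = g x} ->
  mu.-integrable D (EFin \o f) /\ \int[mu]_(x in D) f x = \int[mu]_(x in D) g x.
Proof.
move=> mD mf ig fg.
have mf' : measurable_fun D (EFin \o f) by exact/measurable_EFinP.
have mg' : measurable_fun D (EFin \o g) by exact: measurable_int ig.
have fg' : ae_eq mu D (EFin \o f) (EFin \o g).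
  by apply: ae_impl fg => x fg /fg /= ->.
split; last by rewrite /Rintegral; congr fine; apply: (@ae_eq_integral _ _ _ mu D (EFin \o g) (EFin \o f)).
apply/integrableP; split => //.
rewrite (_ : integral _ _ _ = \int[mu]_(x in D) (abse \o (EFin \o g)) x)%E; last first.
  apply: ae_eq_integral => //; [exact: measurableT_comp|exact: measurableT_comp|].
  by apply: ae_impl fg => x fg /fg /= ->.
by have /integrableP[] := ig.
Qed.

(** The segment is enlarged on both sides so that the density agrees with the
    derivative almost everywhere on all of ]a, b]. *)
Lemma loc_abs_continuous_FTC u a b : zero_extended u -> loc_abs_continuous u -> 0 < a -> a <= b ->
  mu.-integrable `]a, b] (EFin \o u^`()%classic) /\
  \int[mu]_(t in `]a, b]) u^`()%classic t = u b - u a.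
Proof.
move=> zu acu a0 ab.
have a2 : 0 < a / 2 by rewrite divr_gt0.
have ab' : a / 2 < b + 1 by lra.
have [h [ih hE hae]] := loc_abs_continuous_density acu a2 ab'.
have mab : measurable (`]a, b]%classic : set R) by exact: measurable_itv.
have -> : u b - u a = \int[mu]_(t in `]a, b]) h t.
  rewrite -(@Rintegral_itvB _ h (BRight (a / 2)) (BRight b) a) ?bnd_simp//; [|exact: integrableS ih|lra].
  by rewrite -!hE; [ring|lra|lra].
apply: ae_eq_integrable => //.
- apply: (@measurable_funS _ _ _ _ (Rplus R)) => //; first exact: measurable_itv.
    by move=> x /=; rewrite RplusE in_itv/= => /andP[+ _]; exact: lt_trans.
  exact: loc_abs_continuous_measurable_derive1.
- exact: integrableS ih.
- apply: ae_impl hae => x H /=; rewrite in_itv/= => /andP[ax xb].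
  by have /H[] : a / 2 < x < b + 1 by apply/andP; split; lra.
Qed.

(** The converse: the integral of |f| over a set of small measure is small. *)
Lemma abs_continuous_on_primitive u f a b : mu.-integrable [set: R] (EFin \o f) ->
  (forall s t, a <= s -> s <= t -> t <= b -> u t - u s = \int[mu]_(x in `]s, t[) f x) ->
  abs_continuous_on a b u.
Proof.
move=> intf uE e /(integral_normr_continuous intf)[d [d0 H]].
exists d => // n s t st tst sumd.
pose F (i : 'I_n) : set R := `]s i, t i[%classic.
have mF (i : 'I_n) : measurable (F i) by exact: measurable_itv.
pose A : set R := \big[setU/set0]_(i < n) F i.
have mA : measurable A by apply: bigsetU_measurable.
have muA : (mu A < d%:E)%E.
  rewrite /A (measure_bigsetU_ord mu)// (eq_bigr (fun i => (t i - s i)%:E)).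
    by rewrite sumEFin lte_fin.
  move=> i _; rewrite [LHS]lebesgue_measure_itv/= lte_fin.
  have [_ [sti _]] := st i; case: ltP => // tis.
  by rewrite (_ : t i = s i) ?subrr//; apply/eqP; rewrite eq_le tis sti.
have iabs (D : set R) : measurable D -> mu.-integrable D (EFin \o (fun x => `|f x|)).
  move=> mD; have : mu.-integrable D (abse \o (EFin \o f)).
    by apply: integrable_abse; exact: integrableS intf.
  by [].
apply: le_lt_trans (H A mA muA).
have -> : \int[mu]_(x in A) `|f x| = \sum_(i < n) \int[mu]_(x in F i) `|f x|.
  apply: EFin_inj; rewrite -sumEFin fineK; last exact: integrable_fin_num (iabs _ mA).
  rewrite [RHS](eq_bigr (fun i => \int[mu]_(x in F i) (`|f x|)%:E)%E); last first.
    move=> i _; rewrite fineK//; apply: integrable_fin_num; first exact: mF.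
    exact: iabs (mF i).
  rewrite /A [LHS]ge0_integral_bigsetU//.
  - by rewrite /index_enum; case: index_enum_key => /=; rewrite -enumT enum_uniq.
  - exact: sub_trivIset tst.
  - by apply: (@measurable_int _ _ _ mu); exact: iabs.
apply: ler_sum => i _; have [asi [sti tib]] := st i.
by rewrite uE//; apply: le_normr_Rintegral => //; exact: integrableS intf.
Qed.

Lemma Rintegral_itv0B v s t :
  (forall r : R, 0 < r -> mu.-integrable `]0, r[ (EFin \o v)) -> 0 < s -> s <= t ->
  \int[mu]_(x in `]0, t[) v x - \int[mu]_(x in `]0, s[) v x =
  \int[mu]_(x in `]s, t[) v x.
Proof.
move=> iv s0 st; have t10 : 0 < t + 1 by lra.
have sub (i : interval R) : [set` i] `<=` `]0, t + 1[ -> mu.-integrable [set` i] (EFin \o v).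
  by move=> si; apply: integrableS (iv _ t10) => //.
have it : mu.-integrable `]s, t[ (EFin \o v).
  by apply: sub => x /=; rewrite !in_itv/= => /andP[? ?]; apply/andP; split; lra.
rewrite (Rintegral_itv_bndo_bndc it) !Rintegral_itv_bndo_bndc.
- rewrite (@Rintegral_itvB _ v (BRight 0) (BRight t) s) ?bnd_simp//; last exact: ltW.
  by apply: sub => x /=; rewrite !in_itv/= => /andP[? ?]; apply/andP; split; lra.
- by apply: sub => x /=; rewrite !in_itv/= => /andP[? ?]; apply/andP; split; lra.
- by apply: sub => x /=; rewrite !in_itv/= => /andP[? ?]; apply/andP; split; lra.
Qed.

Lemma primitive_from0_increment v c u s t : primitive_from0 v c u -> 0 < s -> s <= t ->
  u t - u s = \int[mu]_(x in `]s, t[) v x.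
Proof.
move=> pv s0 st; rewrite (pv _ (lt_le_trans s0 st)).2 (pv _ s0).2.
by rewrite -Rintegral_itv0B// => [|r /pv[]//]; ring.
Qed.

(** A v integrable on every ]0, t[ is, almost everywhere, the derivative of
    its primitives; this is what identifies a primitive of an L^p function as
    an element of the Dirichlet space. *)
Lemma primitive_from0_abs_continuous v c u : primitive_from0 v c u ->
  loc_abs_continuous u /\
  {ae mu, forall x, 0 < x -> derivable u x 1 /\ u^`()%classic x = v x}.
Proof.
move=> pv.
have setup b : 0 < b -> mu.-integrable [set: R] (EFin \o (v \_ `]0, b[)).
  move=> b0; rewrite -restrict_EFin; apply/integrable_restrict => //=; rewrite setTI.
  exact: (pv _ b0).1.
have vE s t b : 0 < s -> s <= t -> t <= b ->
    u t - u s = \int[mu]_(x in `]s, t[) (v \_ `]0, b[) x.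
  move=> s0 st tb; rewrite (primitive_from0_increment pv)//.
  apply: eq_Rintegral => x; rewrite inE/= in_itv/= => /andP[sx xt].
  by rewrite patchE mem_set//= in_itv/=; apply/andP; split; lra.
split=> [a b a0 ab|].
  apply: (abs_continuous_on_primitive (setup _ (lt_trans a0 ab))) => s t sa st tb.
  by apply: vE => //; exact: lt_le_trans sa.
apply: ae_itv_exhaust => a b a0 ab; have b0 := lt_trans a0 ab.
have := @primitive_derivable_ae u _ a b (setup _ b0).
have H : forall x, a <= x <= b -> u x - u a = \int[mu]_(t in `]a, x]) (v \_ `]0, b[) t.
  move=> x /andP[ax xb]; rewrite -Rintegral_itv_bndo_bndc; first exact: vE.
  by apply: integrableS (setup _ b0).
move=> /(_ H); apply: ae_impl => x Hx /[dup] axb /Hx[dx ->]; split => //.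
by rewrite patchE mem_set//= in_itv/=; apply/andP; split; move: axb => /andP[]; lra.
Qed.

End fundamental_theorem.

(** * Weighted Lebesgue spaces *)

Section weighted_spaces.
Context {R : realType} (p : R) (w : R -> R).
Hypotheses (p_gt1 : 1 < p) (w_gt0 : forall t : R, 0 < t -> 0 < w t)
  (w_cont : {within Rplus R, continuous w}).
Implicit Types (f g v : R -> R) (A : set R) (t : R).
Local Notation mu := (@lebesgue_measure R).

Let p_gt0 : 0 < p. Proof. exact: lt_trans p_gt1. Qed.
Let p_neq0 : p != 0. Proof. by rewrite gt_eqF. Qed.

Lemma measurable_Rplus : measurable (Rplus R).
Proof. exact: measurable_itv. Qed.
Local Hint Resolve measurable_Rplus : core.

Lemma measurable_weight : measurable_fun (Rplus R) w.
Proof. exact: subspace_continuous_measurable_fun. Qed.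

Lemma measurable_weight_powR r : measurable_fun (Rplus R) (fun x => w x `^ r).
Proof. by apply: (measurableT_comp (measurable_powR r)); exact: measurable_weight. Qed.

(** The weight whose integral near 0 the condition B_p(0) requires to be
    finite; it is w^(-q/p) for the conjugate exponent q of p. *)
Definition dual_weight x := w x `^ (- (p - 1)^-1).

(** Multiplication by w^(1/p) and extension by 0 embed the weighted space
    isometrically into the unweighted one on the line, to which the Minkowski
    and Hoelder inequalities apply. *)
Definition times_root_weight A f := (fun x => f x * w x `^ p^-1) \_ A.

Lemma measurable_times_root_weight A f : measurable A -> A `<=` Rplus R ->
  measurable_fun A f -> measurable_fun setT (times_root_weight A f).
Proof.
move=> mA AR mf; apply/(measurable_restrictT _ _).1 => //.
apply: measurable_funM => //; apply: measurable_funS (measurable_weight_powR _) => //.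
Qed.

Lemma powR_times_root f x : 0 < x -> `|f x * w x `^ p^-1| `^ p = `|f x| `^ p * w x.
Proof.
move=> x0; rewrite normrM powRM// [`|_ `^ _|]ger0_norm ?powR_ge0// -powRrM mulVf// powRr1//.
exact/ltW/w_gt0.
Qed.

Lemma Lnorm_times_root_weight A f : A `<=` Rplus R ->
  ('N[mu]_p%:E[EFin \o times_root_weight A f] =
   (\int[mu]_(x in A) (`|f x| `^ p * w x)%:E) `^ p^-1)%E.
Proof.
move=> AR; rewrite unlock [in RHS]integral_mkcond; congr (_ `^ _)%E.
apply: eq_integral => x _; rewrite /= /times_root_weight !patchE.
case: ifPn => [/[!inE] Ax|_].
  by rewrite powR_times_root//; have := AR _ Ax; rewrite RplusE.
by rewrite normr0 powR0.
Qed.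

Lemma wLnormE f : wLnorm p w f = ('N[mu]_p%:E[EFin \o times_root_weight (Rplus R) f])%E.
Proof. by rewrite Lnorm_times_root_weight. Qed.

Lemma wLnorm_ge0 f : (0 <= wLnorm p w f)%E.
Proof. by rewrite wLnormE; exact: Lnorm_ge0. Qed.

Lemma wLnorm_fineK f : wLp p w f -> (fine (wLnorm p w f))%:E = wLnorm p w f.
Proof. by move=> [_ fy]; rewrite fineK// ge0_fin_numE// wLnorm_ge0. Qed.

Lemma measurable_weighted_powR A f : measurable A -> A `<=` Rplus R ->
  measurable_fun A f -> measurable_fun A (fun x => `|f x| `^ p * w x).
Proof.
move=> mA AR mf; apply: measurable_funM.
  by apply: (measurableT_comp (measurable_powR p)); exact: measurableT_comp.
exact: measurable_funS measurable_weight.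
Qed.

Lemma weighted_ge0 f x : 0 < x -> 0 <= `|f x| `^ p * w x.
Proof. by move=> /w_gt0/ltW w0; rewrite mulr_ge0// powR_ge0. Qed.

Lemma wLnorm_ae f g : measurable_fun (Rplus R) f -> measurable_fun (Rplus R) g ->
  {ae mu, forall x, 0 < x -> f x = g x} -> wLnorm p w f = wLnorm p w g.
Proof.
move=> mf mg fg; rewrite /wLnorm; congr (_ `^ _)%E.
apply: ge0_ae_eq_integral => //.
- by apply/measurable_EFinP; exact: measurable_weighted_powR.
- by apply/measurable_EFinP; exact: measurable_weighted_powR.
- by move=> x; rewrite RplusE lee_fin => /weighted_ge0.
- by move=> x; rewrite RplusE lee_fin => /weighted_ge0.
- by apply: ae_impl fg => x fg; rewrite RplusE => /fg ->.
Qed.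

Lemma wLp_ae f g : measurable_fun (Rplus R) f ->
  {ae mu, forall x, 0 < x -> f x = g x} -> wLp p w g -> wLp p w f.
Proof.
move=> mf fg [mg gy]; split; first exact: mf.
by apply: le_lt_trans gy; rewrite (wLnorm_ae mf mg fg).
Qed.

Lemma wLp0 : wLp p w (cst 0).
Proof.
split; first exact: measurable_cst.
rewrite wLnormE (_ : EFin \o _ = cst 0%E) ?Lnorm0 ?ltry ?eqe//.
by apply/funext => x; rewrite /= /times_root_weight patchE mul0r if_same.
Qed.

Lemma wLnormZ k f : measurable_fun (Rplus R) f ->
  wLnorm p w (k \*o f) = (`|k|%:E * wLnorm p w f)%E.
Proof.
move=> mf; rewrite /wLnorm.
have -> : (\int[mu]_(t in Rplus R) (`|(k \*o f)%R t| `^ p * w t)%:E =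
    (`|k| `^ p)%:E * \int[mu]_(t in Rplus R) (`|f t| `^ p * w t)%:E)%E.
  rewrite -ge0_integralZl//.
  - by apply: eq_integral => x _; rewrite /= normrM powRM// -mulrA EFinM.
  - by apply/measurable_EFinP; exact: measurable_weighted_powR.
  - by move=> x; rewrite RplusE lee_fin => /weighted_ge0.
rewrite poweRM ?lee_fin ?powR_ge0//; last first.
  by apply: integral_ge0 => x; rewrite RplusE lee_fin => /weighted_ge0.
by rewrite poweR_EFin -powRrM mulfV// powRr1.
Qed.

Lemma wLpZ k f : wLp p w f -> wLp p w (k \*o f).
Proof.
move=> fL; have [mf fy] := fL; split; first exact: measurable_funM.
by rewrite wLnormZ// -(wLnorm_fineK fL) -EFinM ltry.
Qed.

Lemma wLnormD f g : wLp p w f -> wLp p w g ->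
  wLp p w (f \+ g) /\ (wLnorm p w (f \+ g)%R <= wLnorm p w f + wLnorm p w g)%E.
Proof.
move=> [mf fy] [mg gy].
have mfg : measurable_fun (Rplus R) (f \+ g) by exact: measurable_funD.
have le : (wLnorm p w (f \+ g)%R <= wLnorm p w f + wLnorm p w g)%E.
  rewrite !wLnormE (_ : _ \o _ = EFin \o
      (times_root_weight (Rplus R) f \+ times_root_weight (Rplus R) g)%R); last first.
    apply/funext => x; rewrite /= /times_root_weight !patchE.
    by case: ifPn => _; rewrite ?mulrDl ?addr0.
  by apply: minkowski_EFin; [exact: measurable_times_root_weight|
    exact: measurable_times_root_weight|exact: ltW].
split; last exact: le.
by split; [exact: mfg|exact: le_lt_trans le (lte_add_pinfty fy gy)].
Qed.

Lemma wLnorm_eq0 f : wLp p w f -> wLnorm p w f = 0%E ->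
  {ae mu, forall x, 0 < x -> f x = 0}.
Proof.
move=> [mf _]; rewrite wLnormE => /Lnorm_eq0_eq0.
have mE : measurable_fun setT (EFin \o times_root_weight (Rplus R) f).
  by apply/measurable_EFinP; exact: measurable_times_root_weight.
move=> /(_ mE); rewrite lte_fin => /(_ p_gt0); apply: ae_impl => x + x0.
move=> /(_ I)[] /eqP; rewrite /times_root_weight patchE mem_set; last by rewrite RplusE.
by rewrite mulf_eq0 (gt_eqF (powR_gt0 _ (w_gt0 x0))) orbF => /eqP.
Qed.

(** Hoelder's inequality for the factors v w^(1/p) and w^(-1/p). *)
Lemma weighted_hoelder A v : measurable A -> A `<=` Rplus R -> measurable_fun A v ->
  (\int[mu]_(x in A) `|v x|%:E <=
   (\int[mu]_(x in A) (`|v x| `^ p * w x)%:E) `^ p^-1 *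
   (\int[mu]_(x in A) (dual_weight x)%:E) `^ (1 - p^-1))%E.
Proof.
move=> mA AR mv.
have q0 : 0 < 1 - p^-1 by rewrite subr_gt0 invf_lt1.
have q_neq0 : 1 - p^-1 != 0 by rewrite gt_eqF.
pose g := (fun x => w x `^ (- p^-1)) \_ A.
have mg : measurable_fun setT g.
  apply/(measurable_restrictT _ _).1 => //.
  by apply: measurable_funS (measurable_weight_powR _).
have := @hoelder _ _ _ mu (times_root_weight A v) g p (1 - p^-1)^-1
  (measurable_times_root_weight mA AR mv) mg p_gt0.
rewrite invr_gt0 q0 invrK subrKC => /(_ isT erefl).
rewrite Lnorm_times_root_weight//; congr (_ <= _ * _)%E.
  rewrite Lnorm1 [RHS]integral_mkcond; apply: eq_integral => x _ /=.
  rewrite /times_root_weight /g !patchE; case: ifPn => [/[!inE] Ax|_]; last by rewrite mul0r normr0.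
  have wx : 0 < w x by apply: w_gt0; have := AR _ Ax; rewrite RplusE.
  by rewrite -mulrA -powRD ?subrr ?(gt_eqF wx) ?implybT// powRr0 mulr1.
rewrite unlock invrK [in RHS]integral_mkcond; congr (_ `^ _)%E.
apply: eq_integral => x _ /=.
rewrite /g !patchE; case: ifPn => [/[!inE] Ax|_]; last first.
  by rewrite normr0 powR0// invr_neq0.
rewrite ger0_norm ?powR_ge0// -powRrM /dual_weight; congr (_ `^ _)%:E.
have p1 : p - 1 != 0 by rewrite subr_eq0 gt_eqF.
by field; rewrite p_neq0 p1.
Qed.

End weighted_spaces.

(** * Integrability near the origin *)

Section trace_estimate.
Context {R : realType} (p : R) (w : R -> R).
Hypotheses (p_gt1 : 1 < p) (w_gt0 : forall t : R, 0 < t -> 0 < w t)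
  (w_cont : {within Rplus R, continuous w}) (w_Bp0 : in_Bp0 p w).
Implicit Types (f g v : R -> R) (A : set R) (t : R).
Local Notation mu := (@lebesgue_measure R).

Let p_gt0 : 0 < p. Proof. exact: lt_trans p_gt1. Qed.

Lemma itv0_sub_Rplus t : `]0, t[ `<=` Rplus R.
Proof. by move=> x /=; rewrite RplusE in_itv/= => /andP[]. Qed.
Local Hint Resolve itv0_sub_Rplus : core.

Lemma measurable_dual_weight A : measurable A -> A `<=` Rplus R ->
  measurable_fun A (dual_weight p w).
Proof.
move=> mA AR; apply: measurable_funS (measurable_weight_powR w_cont _) => //.
exact: measurable_Rplus.
Qed.

Lemma dual_weight_gt0 x : 0 < x -> 0 < dual_weight p w x.
Proof. by move=> /w_gt0; exact: powR_gt0. Qed.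

Lemma continuous_dual_weight x : 0 < x -> {for x, continuous (dual_weight p w)}.
Proof.
move=> x0; apply: (@continuous_comp _ _ _ w (fun y => y `^ (- (p - 1)^-1))).
  move: w_cont; rewrite continuous_open_subspace; last exact: interval_open.
  by apply; rewrite inE RplusE.
apply: differentiable_continuous; apply/derivable1_diffP.
by apply: derivable_powR; rewrite in_itv/= andbT; exact: w_gt0.
Qed.

(** Near 0 this is the condition B_p(0); on [1, t] the weight is continuous and
    positive. *)
Lemma integrable_dual_weight t :
  mu.-integrable `]0, t[ (EFin \o dual_weight p w).
Proof.
pose T := Num.max t 1.
have m1 : measurable (`]0%R, 1%R[%classic : set R) by exact: measurable_itv.
have mT : measurable (`[1%R, T]%classic : set R) by exact: measurable_itv.
have TR : `[1, T] `<=` Rplus R.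
  by move=> x /=; rewrite RplusE in_itv/= => /andP[+ _]; exact: lt_le_trans.
have i1 : (\int[mu]_(x in `]0%R, 1%R[) (dual_weight p w x)%:E < +oo)%E by exact: w_Bp0.
have iT : mu.-integrable `[1, T] (EFin \o dual_weight p w).
  apply: continuous_compact_integrable; first exact: segment_compact.
  apply: continuous_in_subspaceT => x; rewrite inE => /TR; rewrite RplusE.
  exact: continuous_dual_weight.
have mU : measurable_fun (`]0%R, 1%R[ `|` `[1, T]) (dual_weight p w).
  apply: measurable_dual_weight; first exact: measurableU.
  by move=> x [/itv0_sub_Rplus|/TR].
have iU : mu.-integrable (`]0%R, 1%R[ `|` `[1, T]) (EFin \o dual_weight p w).
  apply/integrableP; split; first exact/measurable_EFinP.
  rewrite ge0_integral_setU//.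
  - apply: lte_add_pinfty; last by have /integrableP[] := iT.
    apply: le_lt_trans i1; rewrite le_eqVlt; apply/orP; left; apply/eqP.
    by apply: eq_integral => x _; rewrite /= ger0_norm// powR_ge0.
  - by apply/measurable_EFinP; exact: measurableT_comp.
  - apply/disj_set2P/seteqP; split => x //= []; rewrite !in_itv/= => /andP[_ +] /andP[+ _].
    by move=> h1 h2; have := lt_le_trans h1 h2; rewrite ltxx.
apply: integrableS iU => //; first exact: measurableU.
move=> x /=; rewrite !in_itv/= => /andP[x0 xt].
have [x1|x1] := ltP x 1; [by left; rewrite x0|right].
by rewrite /T le_max (ltW xt).
Qed.

(** The integral of a positive function over a set of positive measure does not
    vanish. *)
Lemma Omega0_gt0 t : 0 < t -> 0 < Omega0 p w t.
Proof.
move=> t0; apply: powR_gt0; rewrite lt_neqAle eq_sym; apply/andP; split; last first.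
  by apply: Rintegral_ge0 => x _; exact: powR_ge0.
apply/eqP => I0.
have mt : measurable (`]0, t[%classic : set R) by exact: measurable_itv.
have := ae_eq_integral_abs mu mt (measurable_int mu (integrable_dual_weight t)).
move=> [+ _].
have -> : (\int[mu]_(x in `]0%R, t[) `|(EFin \o dual_weight p w) x| = 0)%E.
  transitivity (\int[mu]_(x in `]0%R, t[) (dual_weight p w x)%:E)%E.
    by apply: eq_integral => x _; rewrite /= ger0_norm// powR_ge0.
  rewrite -[LHS]fineK; first by congr (_%:E); exact: I0.
  exact: integrable_fin_num (integrable_dual_weight t).
move=> /(_ erefl)[N [mN N0 sub]].
have tN : `]0, t[ `<=` N.
  move=> x xt; apply: sub => /=; apply/not_implyP; split => // -[] /eqP.
  by rewrite gt_eqF// dual_weight_gt0//; move: xt; rewrite /= in_itv/= => /andP[].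
have : (mu `]0%R, t[ <= mu N)%E by apply: le_measure; rewrite ?inE.
rewrite lebesgue_measure_itv/= lte_fin t0 oppr0 adde0 [X in (_ <= X)%E]N0 lee_fin.
by rewrite leNgt t0.
Qed.

Lemma Omega0_le s t : s <= t -> Omega0 p w s <= Omega0 p w t.
Proof.
move=> st; apply: ge0_ler_powR; rewrite ?nnegrE.
- by rewrite subr_ge0 invf_le1// ltW.
- by apply: Rintegral_ge0 => x _; exact: powR_ge0.
- by apply: Rintegral_ge0 => x _; exact: powR_ge0.
have sub : `]0, s[ `<=` `]0, t[.
  by move=> x /=; rewrite !in_itv/= => /andP[-> /lt_le_trans]; apply.
apply: fine_le.
- exact: integrable_fin_num (integrable_dual_weight s).
- exact: integrable_fin_num (integrable_dual_weight t).
apply: ge0_subset_integral => //; first by apply: measurable_int; exact: integrable_dual_weight.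
by move=> x _; rewrite lee_fin powR_ge0.
Qed.

(** The weighted norm of v over ]0, t[. Unlike the full norm it tends to 0 with
    t, and this gives the limit 0, and not only boundedness, in the third
    description of the trace classes. *)
Definition head_norm v t :=
  (\int[mu]_(x in `]0, t[) (`|v x| `^ p * w x)) `^ p^-1.

Lemma integrable_weighted v : wLp p w v ->
  mu.-integrable (Rplus R) (EFin \o (fun x => `|v x| `^ p * w x)).
Proof.
move=> [mv vy]; apply/integrableP; split.
  apply/measurable_EFinP; apply: measurable_weighted_powR => //; exact: measurable_Rplus.
rewrite [X in (X < _)%E](_ : _ = \int[mu]_(x in Rplus R) (`|v x| `^ p * w x)%:E)%E; last first.
  apply: eq_integral.
  move=> x; rewrite inE RplusE => /(weighted_ge0 p w_gt0 v) vx.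
  by rewrite /= ger0_norm.
by apply: lty_poweRy vy; rewrite invr_eq0 gt_eqF.
Qed.

Lemma integrable_weighted_head v t : wLp p w v ->
  mu.-integrable `]0, t[ (EFin \o (fun x => `|v x| `^ p * w x)).
Proof.
move=> /integrable_weighted; apply: integrableS => //; exact: measurable_Rplus.
Qed.

Lemma head_norm_le v t : wLp p w v -> head_norm v t <= fine (wLnorm p w v).
Proof.
move=> vL; rewrite -lee_fin wLnorm_fineK// /head_norm /wLnorm -poweR_EFin.
have t0 x : `]0, t[%classic x -> 0 <= `|v x| `^ p * w x.
  by move=> /itv0_sub_Rplus; rewrite RplusE; exact: weighted_ge0.
apply: gt0_ler_poweR; first by rewrite invr_ge0 ltW.
- by rewrite in_itv/= lee_fin Rintegral_ge0//= leey.
- rewrite in_itv/= leey andbT; apply: integral_ge0 => x; rewrite RplusE lee_fin.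
  exact: weighted_ge0.
rewrite fineK; last exact: integrable_fin_num (integrable_weighted_head t vL).
apply: ge0_subset_integral => //; first exact: measurable_Rplus.
  exact: measurable_int (integrable_weighted vL).
by move=> x; rewrite RplusE lee_fin; exact: weighted_ge0.
Qed.

Lemma head_norm_small v (e : R) : wLp p w v -> 0 < e ->
  exists2 d : R, 0 < d & forall t, 0 < t -> t < d -> head_norm v t < e.
Proof.
move=> vL e0.
pose g := (fun x => `|v x| `^ p * w x) \_ (Rplus R).
have ig : mu.-integrable [set: R] (EFin \o g).
  rewrite -restrict_EFin; apply/integrable_restrict => //=; first exact: measurable_Rplus.
  by rewrite setTI; exact: integrable_weighted.
have [d [d0 H]] := integral_normr_continuous ig (powR_gt0 p e0).
exists d => // t t0 td.
have mutd : (mu `]0%R, t[ < d%:E)%E.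
  by rewrite lebesgue_measure_itv/= lte_fin t0 oppr0 adde0 lte_fin.
have lt := H _ (measurable_itv _) mutd.
rewrite -[ltRHS]powRr1 ?(ltW e0)// -(mulfV (lt0r_neq0 p_gt0)) powRrM.
apply: gt0_ltr_powR; rewrite ?invr_gt0// ?nnegrE ?powR_ge0//.
  by apply: Rintegral_ge0 => x /itv0_sub_Rplus; rewrite RplusE; exact: weighted_ge0.
apply: le_lt_trans lt; rewrite le_eqVlt; apply/orP; left; apply/eqP.
apply: eq_Rintegral => x; rewrite inE => /itv0_sub_Rplus xR.
rewrite /g patchE mem_set//= [RHS]ger0_norm//; apply: weighted_ge0 => //.
by move: xR; rewrite RplusE.
Qed.

(** The estimate on which everything rests: functions of the weighted space are
    integrable up to 0, with a primitive of order o(Omega). *)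
Lemma wLp_primitive_estimate v t : wLp p w v ->
  mu.-integrable `]0, t[ (EFin \o v) /\
  `|\int[mu]_(x in `]0, t[) v x| <= head_norm v t * Omega0 p w t.
Proof.
move=> vL; have [mv vy] := vL.
have mt : measurable (`]0, t[%classic : set R) by exact: measurable_itv.
have mvt : measurable_fun `]0, t[ v by apply: measurable_funS mv => //; exact: measurable_Rplus.
have := weighted_hoelder p_gt1 w_gt0 w_cont mt (@itv0_sub_Rplus t) mvt.
rewrite -[X in (_ <= X `^ _ * _)%E]fineK; last first.
  exact: integrable_fin_num (integrable_weighted_head t vL).
rewrite -[X in (_ <= _ * X `^ _)%E]fineK; last first.
  exact: integrable_fin_num (integrable_dual_weight t).
rewrite !poweR_EFin -EFinM => le.
have iv : mu.-integrable `]0, t[ (EFin \o v).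
  apply/integrableP; split; first exact/measurable_EFinP.
  by apply: le_lt_trans le _; rewrite ltry.
split; first exact: iv.
have h : `|\int[mu]_(x in `]0, t[) v x| <= \int[mu]_(x in `]0, t[) `|v x|.
  exact: le_normr_Rintegral.
apply: (le_trans h).
rewrite -lee_fin fineK//.
have : mu.-integrable `]0, t[ (abse \o (EFin \o v)) by exact: integrable_abse.
exact: integrable_fin_num.
Qed.

End trace_estimate.

(** * The weighted Dirichlet space and its trace *)

Section dirichlet_space.
Context {R : realType} (p : R) (w : R -> R).
Hypotheses (p_gt1 : 1 < p) (w_gt0 : forall t : R, 0 < t -> 0 < w t)
  (w_cont : {within Rplus R, continuous w}) (w_Bp0 : in_Bp0 p w).
Implicit Types (u v : R -> R) (c t : R).
Local Notation mu := (@lebesgue_measure R).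
Local Notation D := (D1p p w).
Local Notation Omega := (Omega0 p w).

Definition deriv_norm u : R := fine (wLnorm p w u^`()%classic).

Lemma deriv_norm_ge0 u : 0 <= deriv_norm u.
Proof. by apply: fine_ge0; exact: wLnorm_ge0. Qed.

Lemma deriv_norm_fineK u : D u -> (deriv_norm u)%:E = wLnorm p w u^`()%classic.
Proof. by move=> [_ _ u'L]; exact: wLnorm_fineK. Qed.

(** By the fundamental theorem on ]s, t], the difference between u and the
    integral of its derivative from 0 has the same value at all points; the
    point 1 is used to name this value. *)
Lemma D1p_primitive u : D u -> exists c, primitive_from0 u^`()%classic c u.
Proof.
move=> [zu acu u'L]; pose J t := \int[mu]_(x in `]0, t[) u^`()%classic x.
have iu' t : 0 < t -> mu.-integrable `]0, t[ (EFin \o u^`()%classic).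
  by move=> _; exact: (wLp_primitive_estimate p_gt1 w_gt0 w_cont w_Bp0 t u'L).1.
have JB s t : 0 < s -> s <= t -> J t - J s = u t - u s.
  move=> s0 st; have [ist <-] := loc_abs_continuous_FTC zu acu s0 st.
  rewrite /J Rintegral_itv0B// Rintegral_itv_bndo_bndc//.
  by apply: integrableS ist => //; exact: subset_itv_oo_oc.
exists (u 1 - J 1) => t t0; split; first exact: iu'.
rewrite -/(J t).
have [t1|/ltW t1] := leP t 1; first by have := JB _ _ t0 t1; lra.
by have := JB _ _ ltr01 t1; lra.
Qed.

Lemma primitive_estimate u c t : D u -> primitive_from0 u^`()%classic c u -> 0 < t ->
  `|u t - c| <= head_norm p w u^`()%classic t * Omega t.
Proof.
move=> [_ _ u'L] pu t0; rewrite (pu _ t0).2 addrK.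
exact: (wLp_primitive_estimate p_gt1 w_gt0 w_cont w_Bp0 t u'L).2.
Qed.

Lemma primitive_cvg u c : D u -> primitive_from0 u^`()%classic c u ->
  u t @[t --> 0^'+] --> c.
Proof.
move=> Du pu; have [_ _ u'L] := Du.
apply/cvgrPdist_lt => e e0.
have O1 : 0 < Omega 1 by exact: Omega0_gt0.
have [d d0 H] := head_norm_small p_gt1 w_gt0 w_cont u'L (divr_gt0 e0 O1).
near=> t.
have t0 : 0 < t by near: t; exact: nbhs_right_gt.
have t1 : t <= 1 by near: t; exact: nbhs_right_le.
have td : t < d by near: t; exact: nbhs_right_lt.
rewrite distrC; apply: le_lt_trans (primitive_estimate Du pu t0) _.
apply: (@le_lt_trans _ _ (head_norm p w u^`()%classic t * Omega 1)).
  by apply: ler_wpM2l; [exact: powR_ge0|exact: Omega0_le].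
by rewrite -ltr_pdivlMr//; exact: H.
Unshelve. all: by end_near. Qed.

Lemma cvg_Tr0 u c : u t @[t --> 0^'+] --> c -> Tr0 u = c.
Proof. by move=> uc; apply/cvg_lim. Qed.

Lemma D1p_Tr0 u : D u -> primitive_from0 u^`()%classic (Tr0 u) u.
Proof.
by move=> Du; have [c pu] := D1p_primitive Du; rewrite (cvg_Tr0 (primitive_cvg Du pu)).
Qed.

Lemma D1p_cvg u : D u -> u t @[t --> 0^'+] --> Tr0 u.
Proof. by move=> Du; apply: primitive_cvg => //; exact: D1p_Tr0. Qed.

Lemma trace_estimate u t : D u -> 0 < t ->
  `|u t - Tr0 u| <= deriv_norm u * Omega t.
Proof.
move=> Du t0; apply: le_trans (primitive_estimate Du (D1p_Tr0 Du) t0) _.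
have [_ _ u'L] := Du.
by apply: ler_wpM2r; [exact: powR_ge0|exact: head_norm_le].
Qed.

Lemma calR0E c : calR0 p w c = [set u | D u /\ Tr0 u = c].
Proof.
apply/seteqP; split => u /= [Du].
  by move=> pu; split => //; exact: cvg_Tr0 (primitive_cvg Du pu).
by move=> <-; split => //; exact: D1p_Tr0.
Qed.

Lemma calB0E c : calB0 p w c = [set u | D u /\ Tr0 u = c].
Proof.
apply/seteqP; split => u /= [Du]; first by move=> /cvg_Tr0.
by move=> <-; split => //; exact: D1p_cvg.
Qed.

(** The limit along any sequence is the full limit, which exists; the sequence
    1/(n+1) serves for the converse. *)
Lemma calA0E c : calA0 p w c = [set u | D u /\ Tr0 u = c].
Proof.
apply/seteqP; split => u /= [Du].
  move=> [t_ [t0 _ t_0 utc]]; split => //.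
  have /cvg_at_rightP/(_ t_ (conj t0 t_0)) uT := D1p_cvg Du.
  exact: (cvg_unique _ uT utc).
move=> <-; split => //; exists (fun n => n.+1%:R^-1).
have h0 : (n.+1%:R^-1 : R) @[n --> \oo] --> (0 : R) by exact: cvg_harmonic.
split => //.
  by move=> m n mn; rewrite lef_pV2 ?posrE ?ltr0n// ler_nat ltnS.
have /cvg_at_rightP := D1p_cvg Du; apply; split => //.
Qed.

(** Omega is bounded near 0, so convergence of the quotient forces u to tend to
    c; conversely the quotient is bounded by the norm of the derivative over
    ]0, t[. *)
Lemma calC0E c : calC0 p w c = [set u | D u /\ Tr0 u = c].
Proof.
apply/seteqP; split => u /=.
  move=> [Du /cvgrPdist_lt uO _]; split => //; apply: cvg_Tr0.
  apply/cvgrPdist_lt => e e0.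
  have O1 : 0 < Omega 1 by exact: Omega0_gt0.
  near=> t.
  have t0 : 0 < t by near: t; exact: nbhs_right_gt.
  have t1 : t <= 1 by near: t; exact: nbhs_right_le.
  have Ot : 0 < Omega t by exact: Omega0_gt0.
  have : `|0 - (u t - c) / Omega t| < e / Omega 1.
    by near: t; apply: uO; exact: divr_gt0.
  rewrite sub0r normrN normrM normfV (gtr0_norm Ot) distrC ltr_pdivrMr// => h.
  have Ole : Omega t <= Omega 1 by exact: Omega0_le.
  apply: (lt_le_trans h); rewrite -mulrA; apply: ler_piMr; first exact: ltW.
  by rewrite mulrC (ler_pdivrMr _ _ O1) mul1r; exact: Ole.
move=> [Du <-]; have [_ _ u'L] := Du; have pu := D1p_Tr0 Du.
have quot t : 0 < t -> `|(u t - Tr0 u) / Omega t| <= head_norm p w u^`()%classic t.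
  move=> t0; have Ot : 0 < Omega t by exact: Omega0_gt0.
  rewrite normrM normfV (gtr0_norm Ot) ler_pdivrMr//.
  exact: primitive_estimate.
split => //.
  apply/cvgrPdist_lt => e e0.
  have [d d0 H] := head_norm_small p_gt1 w_gt0 w_cont u'L e0.
  near=> t.
  have t0 : 0 < t by near: t; exact: nbhs_right_gt.
  have td : t < d by near: t; exact: nbhs_right_lt.
  by rewrite sub0r normrN; apply: le_lt_trans (quot _ t0) _; exact: H.
apply: (@le_lt_trans _ _ (deriv_norm u)%:E); last exact: ltry.
apply: ge_ereal_sup => _ [t + <-]; rewrite RplusE => t0; rewrite lee_fin.
apply: le_trans (ler_norm _) _; apply: le_trans (quot _ t0) _.
exact: head_norm_le.
Unshelve. all: by end_near. Qed.

Lemma abs_continuous_on_linear (a b k : R) u v :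
  abs_continuous_on a b u -> abs_continuous_on a b v ->
  abs_continuous_on a b (k *: u + v).
Proof.
move=> acu acv e e0.
have k0 : 0 < `|k| + 1 by rewrite ltr_wpDl.
have e2 : 0 < e / 2 by rewrite divr_gt0.
have [d d0 H] := acu _ (divr_gt0 e2 k0); have [d' d'0 H'] := acv _ e2.
exists (Num.min d d'); first by rewrite lt_min d0.
move=> n s t st tst; rewrite lt_min => /andP[/(H _ _ _ st tst) Hu /(H' _ _ _ st tst) Hv].
rewrite [e]splitr; apply: le_lt_trans (ltrD _ Hv); last first.
  by move: Hu; rewrite ltr_pdivlMr// mulrC; exact.
rewrite mulr_sumr -big_split/=; apply: ler_sum => i _.
have kE x : (k *: u + v) x = k * u x + v x by [].
rewrite !kE (_ : _ - _ = k * (u (t i) - u (s i)) + (v (t i) - v (s i))); last by ring.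
apply: le_trans (ler_normD _ _) _; rewrite lerD2r normrM ler_wpM2r//.
by rewrite lerDl.
Qed.

(** Almost everywhere only: where u or v is not differentiable, the default
    value of the derivative is not linear. *)
Lemma D1p_derive_linear (k : R) u v : D u -> D v ->
  {ae mu, forall x, 0 < x ->
    (k *: u + v)^`()%classic x = k * u^`()%classic x + v^`()%classic x}.
Proof.
move=> [_ acu _] [_ acv _].
have := loc_abs_continuous_derivable acv.
have : {ae mu, forall x, 0 < x -> derivable u x 1} by exact: loc_abs_continuous_derivable.
apply: filterS2; first exact: (ae_filter_ringOfSetsType mu).
move=> x du dv x0; rewrite !derive1E deriveD; [|exact: derivableZ (du x0)|exact: dv].
by rewrite deriveZ//; exact: du.
Qed.

Lemma D1p_linear (k : R) u v : D u -> D v -> D (k *: u + v).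
Proof.
move=> Du Dv; have [zu acu u'L] := Du; have [zv acv v'L] := Dv.
have z : zero_extended (k *: u + v).
  have kE x : (k *: u + v) x = k * u x + v x by [].
  by move=> t t0; rewrite kE zu// zv// mulr0 addr0.
have ac : loc_abs_continuous (k *: u + v).
  by move=> a b a0 ab; apply: abs_continuous_on_linear; [exact: acu|exact: acv].
have sL := (wLnormD p_gt1 w_gt0 w_cont (wLpZ p_gt1 w_gt0 w_cont k u'L) v'L).1.
split; [exact: z|exact: ac|].
have m : measurable_fun (Rplus R) (k *: u + v)^`()%classic by exact: loc_abs_continuous_measurable_derive1.
by apply: (wLp_ae w_gt0 w_cont m _ sL); exact: D1p_derive_linear.
Qed.

Lemma D1p0 : D 0.
Proof.
have d0 : (0 : R -> R)^`()%classic = cst 0.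
  by apply/funext => x; rewrite -[0]/(cst 0) derive1_cst.
split; first by [].
  move=> a b _ _ e e0; exists 1 => // n s t _ _ _.
  by rewrite big1// => i _; rewrite subrr normr0.
by rewrite d0; exact: wLp0.
Qed.

Lemma deriv_normD u v : D u -> D v -> deriv_norm (u + v) <= deriv_norm u + deriv_norm v.
Proof.
move=> Du Dv; have [zu acu u'L] := Du; have [zv acv v'L] := Dv.
have := D1p_linear 1 Du Dv; rewrite scale1r => Duv; have [zuv acuv uvL] := Duv.
have [sL le] := wLnormD p_gt1 w_gt0 w_cont u'L v'L.
(* An explicit chain of equations: rewriting would compare integrals up to
   conversion. *)
have step (a b c : R) (A A' B C : \bar R) : a%:E = A -> A = A' -> b%:E = B ->
    c%:E = C -> (A' <= B + C)%E -> a <= b + c.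
  by move=> <- <- <- <-; rewrite -EFinD lee_fin.
apply: (step _ _ _ _ _ _ _ (deriv_norm_fineK Duv) _ (deriv_norm_fineK Du) (deriv_norm_fineK Dv) le).
apply: wLnorm_ae; [exact: w_gt0|exact: w_cont|by case: uvL|by case: sL|].
have := D1p_derive_linear 1 Du Dv; rewrite scale1r; apply: ae_impl => x H /H ->.
by rewrite mul1r.
Qed.

Lemma deriv_normZ (k : R) u : D u -> deriv_norm (k *: u) = `|k| * deriv_norm u.
Proof.
move=> Du; have [zu acu u'L] := Du.
have := D1p_linear k Du D1p0; rewrite addr0 => Dku; have [_ _ kuL] := Dku.
have [mu' _] := u'L.
have step (a b : R) (A A' B : \bar R) : a%:E = A -> A = A' -> b%:E = B ->
    A' = (`|k|%:E * B)%E -> a = `|k| * b.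
  by move=> <- <- <- h; apply: EFin_inj; rewrite h EFinM.
apply: (step _ _ _ _ _ (deriv_norm_fineK Dku) _ (deriv_norm_fineK Du)
  (wLnormZ p_gt1 w_gt0 w_cont k mu')).
apply: wLnorm_ae; [exact: w_gt0|exact: w_cont|by case: kuL|
  by case: (wLpZ p_gt1 w_gt0 w_cont k u'L)|].
have := D1p_derive_linear k Du D1p0; rewrite addr0; apply: ae_impl => x H /H ->.
by rewrite -[0]/(cst 0) derive1_cst addr0.
Qed.

Lemma Tr0_linear (k : R) u v : D u -> D v -> Tr0 (k *: u + v) = k * Tr0 u + Tr0 v.
Proof.
move=> Du Dv; apply: cvg_Tr0; apply: cvgD; last exact: D1p_cvg.
by apply: cvgZr; exact: D1p_cvg.
Qed.

(** A vanishing seminorm makes u constant on the half-line, equal to its trace;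
    the values outside vanish by convention. *)
Lemma deriv_norm_eq0 u : D u -> deriv_norm u = 0 -> Tr0 u = 0 -> u = 0.
Proof.
move=> Du n0 T0; have [zu acu u'L] := Du; apply/funext => t.
have [t0|t0] := ltP 0 t; last by apply: zu; rewrite RplusE; apply/negP; rewrite -leNgt.
have [iu ->] := D1p_Tr0 Du t0; rewrite T0 addr0.
have w0 : wLnorm p w u^`()%classic = 0%E.
  by rewrite -(wLnorm_fineK p_gt1 w_gt0 u'L) -/(deriv_norm u) n0.
have ae0 := wLnorm_eq0 p_gt1 w_gt0 w_cont u'L w0.
have mt : measurable (`]0, t[%classic : set R) by exact: measurable_itv.
have mu' : measurable_fun `]0, t[ u^`()%classic.
  by apply/measurable_EFinP; exact: measurable_int iu.
have i0 : mu.-integrable `]0, t[ (EFin \o cst (0 : R)) by exact: integrable0.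
have u'0 : {ae mu, forall x, `]0, t[%classic x -> u^`()%classic x = cst 0 x}.
  by apply: ae_impl ae0 => x H; rewrite /= in_itv/= => /andP[/H].
have [_ ->] := ae_eq_integrable mt mu' i0 u'0.
by rewrite Rintegral_cst// mul0r.
Qed.

End dirichlet_space.

(** * Characterisations of the trace *)

Theorem theorem3p1 (R : realType) (p : R) (w : R -> R)
    (p_gt1 : 1 < p)
    (w_gt0 : forall t : R, 0 < t -> 0 < w t)
    (w_cont : {within Rplus R, continuous w})
    (w_Bp0 : in_Bp0 p w) :
  [/\
    forall c a : R, 0 < a ->
      norm_closed_in (D1p p w) (D1p_norm p w a) (calR0 p w c),
    forall c : R,
      [/\ calA0 p w c = calB0 p w c, calB0 p w c = calC0 p w c &
          calC0 p w c = calR0 p w c],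
    [/\ forall u : R -> R, D1p p w u -> exists c : R, calR0 p w c u,
        forall u : R -> R, D1p p w u -> cvg (u t @[t --> 0^'+]),
        D1p p w = \bigcup_(c in [set: R]) calR0 p w c &
        D1p p w = [set u : R -> R | zero_extended u /\
          exists (c : R) (v : R -> R), wLp p w v /\ primitive_from0 v c u]] &
    norm_on (D1p p w) (D1p_norm0 p w) /\
    forall a : R, 0 < a ->
      equivalent_norms_on (D1p p w) (D1p_norm0 p w) (D1p_norm p w a)].
Proof.
have O_gt0 (a : R) : 0 < a -> 0 < Omega0 p w a by exact: Omega0_gt0.
have lin (k : R) u v : D1p p w u -> D1p p w v -> D1p p w (k *: u + v).
  exact: D1p_linear.
have dist (a : R) u : 0 < a -> D1p p w u ->
    `|u a - Tr0 u| <= deriv_norm p w u * Omega0 p w a.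
  by move=> a0 Du; exact: trace_estimate.
have n_ge0 u : 0 <= deriv_norm p w u by exact: deriv_norm_ge0.
(* The two norms differ by |u a| - |Tr u|, which the trace estimate bounds by
   Omega a times the norm of the derivative. *)
have Na_le (a : R) u : 0 < a -> D1p p w u ->
    D1p_norm p w a u <= (1 + Omega0 p w a) * D1p_norm0 p w u.
  move=> a0 Du; have := dist _ _ a0 Du; rewrite /D1p_norm /D1p_norm0 -/(deriv_norm p w u).
  move: (n_ge0 u) (O_gt0 _ a0) (ler_normD (u a - Tr0 u) (Tr0 u)); rewrite subrK.
  move: (deriv_norm p w u) (Omega0 p w a) => n O n0 O0 h1 h2.
  have := normr_ge0 (Tr0 u); move: `|Tr0 u| h1 => T h1 T0.
  by have := mulr_ge0 (ltW O0) T0; lra.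
have N0_le (a : R) u : 0 < a -> D1p p w u ->
    D1p_norm0 p w u <= (1 + Omega0 p w a) * D1p_norm p w a u.
  move=> a0 Du; have := dist _ _ a0 Du; rewrite /D1p_norm /D1p_norm0 -/(deriv_norm p w u).
  rewrite distrC.
  move: (n_ge0 u) (O_gt0 _ a0) (ler_normD (Tr0 u - u a) (u a)); rewrite subrK.
  move: (deriv_norm p w u) (Omega0 p w a) => n O n0 O0 h1 h2.
  have := normr_ge0 (u a); move: `|u a| h1 => T h1 T0.
  by have := mulr_ge0 (ltW O0) T0; lra.
have calE (c : R) : [/\ calR0 p w c = [set u | D1p p w u /\ Tr0 u = c],
    calA0 p w c = [set u | D1p p w u /\ Tr0 u = c],
    calB0 p w c = [set u | D1p p w u /\ Tr0 u = c] &
    calC0 p w c = [set u | D1p p w u /\ Tr0 u = c]].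
  by split; [exact: calR0E|exact: calA0E|exact: calB0E|exact: calC0E].
split.
(* The trace is continuous for each norm, and the class is its level set. *)
- move=> c a a0; have [-> _ _ _] := calE c; split; first by move=> u [].
  move=> u Du clu; split; first exact: Du.
  have K0 : 0 < 1 + Omega0 p w a by rewrite addr_gt0// O_gt0.
  apply/eqP; rewrite -subr_eq0 -normr_le0; apply/ler_addgt0Pr => e e0; rewrite add0r.
  have [v [Dv Tv] uv] := clu _ (divr_gt0 e0 K0).
  have Duv : D1p p w (u - v).
    by have := lin (-1) v u Dv Du; rewrite scaleN1r addrC.
  have -> : Tr0 u - c = Tr0 (u - v).
    have := Tr0_linear p_gt1 w_gt0 w_cont w_Bp0 (-1) Dv Du.
    by rewrite scaleN1r addrC Tv => ->; rewrite mulN1r addrC.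
  apply: (@le_trans _ _ (D1p_norm0 p w (u - v))); first by rewrite lerDr; exact: n_ge0.
  apply: le_trans (N0_le _ _ a0 Duv) _.
  by rewrite mulrC -ler_pdivlMr//; exact: ltW.
- by move=> c; have [-> -> -> ->] := calE c.
- split.
  + by move=> u Du; exists (Tr0 u); have [-> _ _ _] := calE (Tr0 u).
  + by move=> u Du; apply/cvg_ex; exists (Tr0 u); exact: (D1p_cvg p_gt1 w_gt0 w_cont w_Bp0 Du).
  + apply/seteqP; split => u.
      by move=> Du; exists (Tr0 u); [by []|have [-> _ _ _] := calE (Tr0 u)].
    by move=> [c _ []].
  + apply/seteqP; split => u.
      move=> Du; have [zu _ u'L] := Du; split; first exact: zu.
      exists (Tr0 u), u^`()%classic; split; first exact: u'L.
      exact: (D1p_Tr0 p_gt1 w_gt0 w_cont w_Bp0 Du).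
    move=> [zu [c [v [vL pv]]]].
    have [acu dae] := primitive_from0_abs_continuous pv.
    split; [exact: zu|exact: acu|].
    have m := loc_abs_continuous_measurable_derive1 zu acu.
    by apply: (wLp_ae w_gt0 w_cont m _ vL); apply: ae_impl dae => x H /H[].
- split.
    split.
    + exact: (D1p0 p_gt1 w_gt0).
    + exact: lin.
    + move=> u v Du Dv; rewrite /D1p_norm0.
      have := Tr0_linear p_gt1 w_gt0 w_cont w_Bp0 1 Du Dv; rewrite scale1r mul1r => ->.
      rewrite addrACA; apply: lerD; last exact: ler_normD.
      exact: (deriv_normD p_gt1 w_gt0 w_cont Du Dv).
    + move=> k u Du; rewrite /D1p_norm0 mulrDr -normrM; congr +%R.
        exact: (deriv_normZ p_gt1 w_gt0 w_cont k Du).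
      have D0 : D1p p w 0 by exact: (D1p0 p_gt1 w_gt0).
      congr Num.norm; have T0 : Tr0 (0 : R -> R) = 0 by apply: cvg_Tr0; exact: cvg_cst.
      have := Tr0_linear p_gt1 w_gt0 w_cont w_Bp0 k Du D0.
      by rewrite T0 !addr0.
    + move=> u Du; split; first by apply: addr_ge0 => //; exact: n_ge0.
      move=> N0; have := n_ge0 u; have := normr_ge0 (Tr0 u).
      have N0' : deriv_norm p w u + `|Tr0 u| = 0 by exact: N0.
      move=> T0 n0; have nu : deriv_norm p w u = 0 by lra.
      apply: (deriv_norm_eq0 p_gt1 w_gt0 w_cont w_Bp0 Du nu).
      by apply/eqP; rewrite -normr_eq0; apply/eqP; lra.
  (* Both inequalities hold with the same factor 1 + Omega a. *)
  move=> a a0; exists (1 + Omega0 p w a)^-1, (1 + Omega0 p w a).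
  have K0 : 0 < 1 + Omega0 p w a by rewrite addr_gt0// O_gt0.
  split; [by rewrite invr_gt0|exact: K0|] => u Du; split; last exact: Na_le.
  by rewrite mulrC ler_pdivrMr// mulrC; exact: N0_le.
Qed.
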